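(* Let $\sigma\in\mathcal{D}$ and $\varepsilon\in(0,1]$. The operators $\rho^*_\varepsilon(\sigma)$ and $\rho_{*,\varepsilon}(\sigma)$ defined in the context are states lying in $B_\varepsilon(\sigma)$, and for every $\omega\in B_\varepsilon(\sigma)$, $$\rho^*_\varepsilon(\sigma)\prec\omega\prec\rho_{*,\varepsilon}(\sigma).$$ Moreover: (i) $\rho^*_\varepsilon(\sigma)$ is the unique state $\rho\in B_\varepsilon(\sigma)$ such that $\rho\prec\omega$ for all $\omega\in B_\varepsilon(\sigma)$. (ii) If $\rho\in B_\varepsilon(\sigma)$ satisfies $\omega\prec\rho$ for all $\omega\in B_\varepsilon(\sigma)$, then $\rho$ is unitarily equivalent to $\rho_{*,\varepsilon}(\sigma)$. (iii) $\rho_{*,\varepsilon}(\sigma)$ lies on the boundary of $B_\varepsilon(\sigma)$, and either $\rho^*_\varepsilon(\sigma)=\tau$ or $\rho^*_\varepsilon(\sigma)$ lies on the boundary of $B_\varepsilon(\sigma)$ (boundary taken relative to the affine space of self-adjoint operators on $\mathcal{H}$ of trace one). (iv) (Semigroup property) For all $\varepsilon_1,\varepsilon_2\in(0,1]$, $\rho^*_{\varepsilon_1+\varepsilon_2}(\sigma)=\rho^*_{\varepsilon_1}\big(\rho^*_{\varepsilon_2}(\sigma)\big)$. (v) $\tfrac12\|\sigma-\tau\|_1=\tfrac12\|\tau-\rho^*_\varepsilon(\sigma)\|_1+\tfrac12\|\rho^*_\varepsilon(\sigma)-\sigma\|_1$.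
   Context: $\mathcal{H}$ is a complex Hilbert space of finite dimension $d\ge 2$; $\mathcal{D}$ is the set of states (density matrices: positive semidefinite operators on $\mathcal{H}$ of trace one); $\tau=\frac1d\mathbf{1}$; $\|A\|_1=\mathrm{Tr}|A|$; $B_\varepsilon(\sigma)=\{\omega\in\mathcal{D}:\frac12\|\omega-\sigma\|_1\le\varepsilon\}$. Majorization: for $x,y\in\mathbb{R}^d$ with non-increasing rearrangements $x^\downarrow,y^\downarrow$, $y\prec x$ means $\sum_{j=1}^k y^\downarrow_j\le\sum_{j=1}^k x^\downarrow_j$ for $k=1,\dots,d-1$ and $\sum_{j=1}^d y_j=\sum_{j=1}^d x_j$. For states, $\rho\prec\omega$ means that the vector of eigenvalues (with multiplicity) of $\rho$ is majorized by that of $\omega$. Let $\sigma=\sum_{i=1}^d\mu_i|i\rangle\langle i|$ be an eigendecomposition with $\mu_1\ge\dots\ge\mu_d$ and $(|i\rangle)$ an orthonormal basis. Definition of $\rho^*_\varepsilon(\sigma)$ for $\varepsilon>0$: if $\frac12\|\sigma-\tau\|_1\le\varepsilon$, set $\rho^*_\varepsilon(\sigma)=\tau$. If $\frac12\|\sigma-\tau\|_1>\varepsilon$, there are a unique pair $(\alpha_1,n)\in[0,1]\times\{1,\dots,d-1\}$ with $\sum_{i=d-n+1}^d|\alpha_1-\mu_i|=\varepsilon$ and $\mu_{d-n+1}<\alpha_1\le\mu_{d-n}$, and a unique pair $(\alpha_2,m)\in[0,1]\times\{1,\dots,d-1\}$ with $\sum_{i=1}^m|\alpha_2-\mu_i|=\varepsilon$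 and $\mu_{m+1}\le\alpha_2<\mu_m$; moreover $\alpha_1<\frac1d<\alpha_2$ (so $m\le d-n$). Then $$\rho^*_\varepsilon(\sigma)=\sum_{i=1}^m\alpha_2|i\rangle\langle i|+\sum_{i=m+1}^{d-n}\mu_i|i\rangle\langle i|+\sum_{i=d-n+1}^d\alpha_1|i\rangle\langle i|.$$ Definition of $\rho_{*,\varepsilon}(\sigma)$: write $q_i=\mu_i$ and set $\rho_{*,\varepsilon}(\sigma)=\sum_{i=1}^d p_{i*}|i\rangle\langle i|$, where: if $q_d>\varepsilon$, $(p_{i*})=(q_1+\varepsilon,q_2,\dots,q_{d-1},q_d-\varepsilon)$. Otherwise let $\ell\in\{1,\dots,d-1\}$ be the largest index with $Q_\ell:=\sum_{j=d-\ell+1}^d q_j\le\varepsilon$. If $\ell=d-1$, $(p_{i*})=(1,0,\dots,0)$. If $\ell<d-1$, $p_{1*}=q_1+\varepsilon$, $p_{j*}=q_j$ for $2\le j\le d-\ell-1$, $p_{(d-\ell)*}=q_{d-\ell}-(\varepsilon-Q_\ell)$, and $p_{j*}=0$ for $j\ge d-\ell+1$. *)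

(* Defs.v *)
From HB Require Import structures.
From mathcomp Require Import all_boot all_order all_algebra.
From mathcomp Require Import all_classical all_reals all_analysis.
From mathcomp Require Import complex.

Set Implicit Arguments.
Unset Strict Implicit.
Unset Printing Implicit Defensive.

Import Order.TTheory GRing.Theory Num.Theory numFieldNormedType.Exports.

Local Open Scope ring_scope.
Local Open Scope classical_set_scope.
Local Open Scope complex_scope.
Local Open Scope sesquilinear_scope.

(* The usual topology of the complex numbers, i.e. the one given by the modulus;
   matrices over R[i] then carry the entrywise topology. *)
HB.instance Definition _ (R : realType) := NormedModule.copy R[i] R[i]^o.

(* A d-dimensional complex Hilbert space is represented by C^d, vectors being
   columns, and operators by square matrices.  Vectors of R^d are d-tuples;
   since nth counts from 0, x_k of the usual 1-based indexing is x`_(k.-1). *)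

Section Majorization.
Variables (R : realType) (d : nat).
Implicit Types x y : d.-tuple R.

Definition decr_rearr x : seq R := sort >=%R x.

Definition majorized y x : Prop :=
  (forall k, (1 <= k <= d.-1)%N ->
     \sum_(0 <= j < k) (decr_rearr y)`_j <= \sum_(0 <= j < k) (decr_rearr x)`_j)
  /\ \sum_(0 <= j < d) y`_j = \sum_(0 <= j < d) x`_j.

End Majorization.

Section Operators.
Variables (R : realType) (d : nat).
Notation C := (R[i]).
Implicit Types A B rho omega sigma : 'M[C]_d.

Definition psdmx A : Prop :=
  A \is hermsymmx /\ forall v : 'cV[C]_d, 0 <= (v^t* *m A *m v) 0 0.

Definition state : set 'M[C]_d := [set rho | psdmx rho /\ \tr rho = 1].

Definition mixed_state : 'M[C]_d := d%:R^-1 *: 1%:M.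

(* Square root by functional calculus; meant for positive semidefinite A, for
   which A = invmx (spectralmx A) *m diag_mx (spectral_diag A) *m spectralmx A. *)
Definition sqrtmx A : 'M[C]_d :=
  invmx (spectralmx A) *m diag_mx (map_mx sqrtC (spectral_diag A))
  *m spectralmx A.

Definition absmx A : 'M[C]_d := sqrtmx (A^t* *m A).

Definition trace_norm A : R := complex.Re (\tr (absmx A)).

Definition trace_dist A B : R := 2^-1 * trace_norm (A - B).

Definition tball (eps : R) sigma : set 'M[C]_d :=
  [set omega | state omega /\ trace_dist omega sigma <= eps].

(* Eigenvalues with multiplicity; spectral_diag is real on self-adjoint
   matrices. *)
Definition spectrum A : d.-tuple R :=
  [tuple complex.Re (spectral_diag A 0 i) | i < d].

Definition state_maj rho omega : Prop :=
  majorized (spectrum rho) (spectrum omega).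

Definition unitarily_equiv A B : Prop :=
  exists2 U : 'M[C]_d, U \is unitarymx & A = U *m B *m U^t*.

Definition selfadj_trace1 : set 'M[C]_d :=
  [set A | A \is hermsymmx /\ \tr A = 1].

End Operators.

(* Topological boundary of B as a subset of the subspace X. *)
Definition rel_boundary (T : topologicalType) (X B : set T) : set T :=
  X `&` closure B `&` closure (X `\` B).

Section Eigendecomposition.
Variables (R : realType) (d : nat).
Notation C := (R[i]).

Definition orthonormal_basis (e : 'I_d -> 'cV[C]_d) : Prop :=
  forall i j, ((e i)^t* *m e j) 0 0 = (i == j)%:R.

Definition diag_op (e : 'I_d -> 'cV[C]_d) (mu : d.-tuple R) : 'M[C]_d :=
  \sum_(i < d) (mu`_i)%:C *: (e i *m (e i)^t*).

Definition eigendecomp (sigma : 'M[C]_d) (e : 'I_d -> 'cV[C]_d)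
    (mu : d.-tuple R) : Prop :=
  [/\ orthonormal_basis e, sorted >=%R mu & sigma = diag_op e mu].

End Eigendecomposition.

Section ExtremalStates.
Variables (R : realType) (d : nat) (eps : R).
Notation C := (R[i]).
Implicit Types (mu q : d.-tuple R) (e : 'I_d -> 'cV[C]_d).

(* (alpha_1, n): the n smallest eigenvalues are raised to alpha_1. *)
Definition raise_spec mu (p : R * nat) : Prop :=
  let: (alpha1, n) := p in
  [/\ 0 <= alpha1 <= 1, (1 <= n <= d.-1)%N,
      \sum_(d - n <= i < d) `|alpha1 - mu`_i| = eps
    & mu`_(d - n) < alpha1 <= mu`_(d - n).-1].

(* (alpha_2, m): the m largest eigenvalues are lowered to alpha_2. *)
Definition lower_spec mu (p : R * nat) : Prop :=
  let: (alpha2, m) := p in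
  [/\ 0 <= alpha2 <= 1, (1 <= m <= d.-1)%N,
      \sum_(0 <= i < m) `|alpha2 - mu`_i| = eps
    & mu`_m <= alpha2 < mu`_m.-1].

(* Definite descriptions: when the distance from diag_op e mu to the maximally
   mixed state exceeds eps > 0, each of the two pairs exists and is unique. *)
Definition raise_pair mu : R * nat := get [set p | raise_spec mu p].
Definition lower_pair mu : R * nat := get [set p | lower_spec mu p].

Definition flattened mu : d.-tuple R :=
  let: (alpha1, n) := raise_pair mu in
  let: (alpha2, m) := lower_pair mu in
  [tuple if (i < m)%N then alpha2
         else if (i < d - n)%N then mu`_i else alpha1 | i < d].

(* rho^*_eps *)
Definition rho_upper e mu : 'M[C]_d :=
  if trace_dist (diag_op e mu) (mixed_state R d) <= eps then mixed_state R d
  else diag_op e (flattened mu).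

(* Q_l *)
Definition tail_sum q (l : nat) : R := \sum_(d - l <= j < d) q`_j.

Definition steepened q : d.-tuple R :=
  if eps < q`_d.-1 then
    [tuple if i == 0%N :> nat then q`_i + eps
           else if i == d.-1 :> nat then q`_i - eps else q`_i | i < d]
  else
    let l := (\max_(l < d | (0 < l)%N && (tail_sum q l <= eps)%R) l)%N in
    if l == d.-1 then [tuple if i == 0%N :> nat then 1 else 0 | i < d]
    else [tuple if i == 0%N :> nat then q`_i + eps
                else if (i < (d - l).-1)%N then q`_i
                else if i == (d - l).-1 :> nat then q`_i - (eps - tail_sum q l)
                else 0 | i < d].

(* rho_{*,eps} *)
Definition rho_lower e q : 'M[C]_d := diag_op e (steepened q).

End ExtremalStates.

(* Main.v *)
Require Import Defs.
From mathcomp Require Import all_boot all_order all_algebra.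
From mathcomp Require Import all_classical all_reals all_analysis.
From mathcomp Require Import complex perm.
From mathcomp Require Import lra ring zify.
Local Open Scope ring_scope.
Local Open Scope classical_set_scope.
Local Open Scope complex_scope.

(** Write [excess t x] for the sum of the positive parts of [x_i - t].  With
    totals equal, [y] is majorized by [x] as soon as [excess t y <= excess t x]
    for all [t], because the sum of the [k] largest entries of [x] is
    [k t + excess t x] when [t] is the [k]-th largest entry and at most that for
    every other [t].  Since the diagonal of an operator in any orthonormal basis
    is the image of its spectrum under a doubly stochastic matrix, convexity
    shows that [excess t] of the spectra of two states differs by at most their
    trace distance.

    The spectrum of [rho^*] is obtained from that of [sigma] by clamping to
    [[alpha_1, alpha_2]], so that its excess is as small as this bound permits
    for [t] between the two levels, and trivially minimal for other [t].  The
    head sums of the spectrum of [rho_*] are [min 1 (S_k(sigma) + eps)], which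
    by the same bound dominate those of any state of the ball.

    If [rho] is another minimizer, it has the same spectrum as [rho^*], and so,
    by the parallelogram law, the midpoint, which belongs to the ball, has a
    strictly smaller Hilbert-Schmidt norm: a contradiction to minimality.  This
    uniqueness also yields the semigroup property. *)
Set Implicit Arguments.
Unset Strict Implicit.
Unset Printing Implicit Defensive.

Import Order.TTheory GRing.Theory Num.Theory numFieldNormedType.Exports.

(** * Excesses and majorization *)

Section Excess.
Variable R : realType.
Implicit Types (x y t a : R) (s : seq R).

Definition excess t x := Num.max 0 (x - t).

Definition excess_sum t s := \sum_(x <- s) excess t x.

Definition clamp a b x := Num.max a (Num.min b x).

Lemma max_cases a b (P : R -> Prop) :
  (a <= b -> P b) -> (b <= a -> P a) -> P (Num.max a b).
Proof.
move=> Pb Pa; have [h|/ltW h] := lerP a b; first exact: Pb.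
exact: Pa.
Qed.

Lemma min_cases a b (P : R -> Prop) :
  (a <= b -> P a) -> (b <= a -> P b) -> P (Num.min a b).
Proof.
move=> Pa Pb; have [h|/ltW h] := lerP a b; first exact: Pa.
exact: Pb.
Qed.

Lemma norm_cases a (P : R -> Prop) : (0 <= a -> P a) -> (a <= 0 -> P (- a)) -> P `|a|.
Proof.
move=> Pp Pn; have [h|/ltW h] := lerP 0 a; first by rewrite ger0_norm//; exact: Pp.
by rewrite ler0_norm//; exact: Pn.
Qed.

Ltac minmax_free t :=
  lazymatch t with
  | context [Order.max _ _] => fail
  | context [Order.min _ _] => fail
  | _ => idtac
  end.

(* Innermost first, so that [lra] never meets a hypothesis containing a maximum. *)
Ltac split_minmax :=
  rewrite /clamp /excess;
  repeat match goal with
  | |- context [Order.max ?a ?b] => minmax_free a; minmax_free b;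
      pattern (Order.max a b); apply: max_cases => ?
  | |- context [Order.min ?a ?b] => minmax_free a; minmax_free b;
      pattern (Order.min a b); apply: min_cases => ?
  | |- context [Num.norm ?a] => minmax_free a;
      pattern (Num.norm a); apply: norm_cases => ?
  end; lra.

Lemma excess_ge0 t x : 0 <= excess t x.
Proof. split_minmax. Qed.

Lemma excess_ge t x : x - t <= excess t x.
Proof. split_minmax. Qed.

Lemma excessE t x : t <= x -> excess t x = x - t.
Proof. move=> ?; split_minmax. Qed.

Lemma excess_eq0 t x : x <= t -> excess t x = 0.
Proof. move=> ?; split_minmax. Qed.

Lemma excess_shiftD t x y : excess t (x + y) <= excess t x + excess 0 y.
Proof. split_minmax. Qed.

Lemma norm_excess x : `|x| = excess 0 x *+ 2 - x.
Proof. split_minmax. Qed.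

Lemma excess_anti t t' x : t <= t' -> excess t' x <= excess t x.
Proof. move=> ?; split_minmax. Qed.

(** [excess (- t) (- x)] is the positive part of [t - x]. Deficits below a level are written
    throughout as excesses of negated numbers, so that one set of lemmas serves both levels. *)
Lemma excess_oppE t x : excess (- t) (- x) = excess t x - (x - t).
Proof. split_minmax. Qed.

Section Clamp.
Variables (a b : R).
Hypothesis ab : a <= b.

(** Clamping cuts off the excess over [b] and fills up the deficit below [a]; it preserves a total
    exactly when these two amounts agree. *)
Lemma clamp_decomp x : x - clamp a b x = excess b x - excess (- a) (- x).
Proof. move: ab; split_minmax. Qed.

Lemma excess_clamp_mid t x : a <= t <= b ->
  excess t (clamp a b x) = excess t x - excess b x.
Proof. move: ab => ? /andP[? ?]; split_minmax. Qed.

Lemma clamp_bounds x : a <= clamp a b x <= b.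
Proof. by move: ab => ?; apply/andP; split; split_minmax. Qed.

Lemma excess_clamp_sub x : excess 0 (clamp a b x - x) = excess (- a) (- x).
Proof. move: ab => ?; split_minmax. Qed.

(** The clamped value lies between [x] and any [c] of the interval, so distances add up; summed over
    the entries this gives (v). *)
Lemma norm_clamp c x : a <= c <= b ->
  `|x - c| = `|c - clamp a b x| + `|clamp a b x - x|.
Proof. move: ab => ? /andP[? ?]; split_minmax. Qed.

Lemma excess_clamp2 a' b' x : a <= a' -> a' <= b' -> b' <= b ->
  excess 0 (clamp a b x - clamp a' b' x) = excess b' x - excess b x.
Proof. move: ab => ? ? ? ?; split_minmax. Qed.

Lemma clamp_const x : a = b -> clamp a b x = a.
Proof. move=> ?; split_minmax. Qed.

End Clamp.

Lemma excess_sum_shiftD t (I : finType) (x y : I -> R) :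
  \sum_i excess t (x i + y i) <= \sum_i excess t (x i) + \sum_i excess 0 (y i).
Proof. by rewrite -big_split; apply: ler_sum => i _; exact: excess_shiftD. Qed.

(** Jensen's inequality for a doubly stochastic matrix: the row sums give convexity in each row, the
    column sums remove the weights after the sums are exchanged. *)
Lemma excess_average t (I J : finType) (D : I -> J -> R) (x : J -> R) :
  (forall i j, 0 <= D i j) -> (forall i, \sum_j D i j = 1) ->
  (forall j, \sum_i D i j = 1) ->
  \sum_i excess t (\sum_j D i j * x j) <= \sum_j excess t (x j).
Proof.
move=> D0 Drow Dcol.
have le1 i : excess t (\sum_j D i j * x j) <= \sum_j D i j * excess t (x j).
  rewrite /excess ge_max; apply/andP; split.
    by apply: sumr_ge0 => j _; rewrite mulr_ge0// excess_ge0.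
  rewrite -[X in _ - X <= _]mulr1 -(Drow i) mulr_sumr -sumrB; apply: ler_sum => j _.
  by rewrite [t * _]mulrC -mulrBr ler_wpM2l//; exact: excess_ge.
apply: le_trans (ler_sum _ (fun i _ => le1 i)) _.
rewrite exchange_big /=; apply: ler_sum => j _.
by rewrite -mulr_suml Dcol mul1r.
Qed.

Lemma head_sum_le s k t : (k <= size s)%N ->
  \sum_(0 <= j < k) s`_j <= t *+ k + excess_sum t s.
Proof.
move=> ks; rewrite /excess_sum [X in _ <= _ + X](big_nth 0).
rewrite [X in _ <= _ + X](big_cat_nat (n:=k))//=.
rewrite addrA -[leLHS]addr0; apply: lerD; last first.
  by apply: sumr_ge0 => i _; exact: excess_ge0.
have -> : t *+ k = \sum_(0 <= j < k) t by rewrite sumr_const_nat subn0.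
rewrite -big_split/=; apply: ler_sum => i _.
by rewrite -lerBlDl excess_ge.
Qed.

Lemma sorted_nth_ge s i j : sorted >=%R s -> (i <= j)%N -> (j < size s)%N ->
  s`_j <= s`_i.
Proof.
move=> ss ij js.
apply: (sorted_leq_nth ge_trans (@lexx _ _) 0 ss) => //.
by rewrite unfold_in /=; exact: leq_ltn_trans js.
Qed.

Lemma sorted_head_sum s k : sorted >=%R s -> (k < size s)%N ->
  \sum_(0 <= j < k.+1) s`_j = s`_k *+ k.+1 + excess_sum s`_k s.
Proof.
move=> ss ks; rewrite /excess_sum [X in _ = _ + X](big_nth 0).
rewrite [X in _ = _ + X](big_cat_nat (n:=k.+1))//=.
have -> : \sum_(k.+1 <= i < size s) excess s`_k s`_i = 0.
  rewrite big_nat big1// => i /andP[ki si].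
  by apply: excess_eq0; apply: sorted_nth_ge => //; exact: ltnW.
have -> : s`_k *+ k.+1 = \sum_(0 <= j < k.+1) s`_k by rewrite sumr_const_nat subn0.
rewrite addr0 -big_split/=; apply: eq_big_nat => i /andP[_ ik].
by rewrite excessE ?subrKC//; apply: sorted_nth_ge.
Qed.

(** Summation by parts: lowering the weight of a nonnegative partial sum from [a n] to [a n.+1] can
    only decrease the result. *)
Lemma abel_sum_ge (a c : nat -> R) n :
  (forall i, (i < n)%N -> a i.+1 <= a i) ->
  (forall k, (k <= n)%N -> 0 <= \sum_(0 <= j < k) c j) ->
  a n * \sum_(0 <= j < n.+1) c j <= \sum_(0 <= j < n.+1) a j * c j.
Proof.
elim: n => [|n IH] a_anti c_ge; first by rewrite !big_nat1.
rewrite [leRHS]big_nat_recr// [X in _ * X]big_nat_recr//= mulrDr lerD2r.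
apply: le_trans (IH _ _); last 2 first.
- by move=> i ni; apply: a_anti; exact: ltnW.
- by move=> k kn; apply: c_ge; exact: leqW.
by apply: ler_wpM2r; [exact: c_ge|exact: a_anti].
Qed.

End Excess.

(** * Majorization of tuples *)

Section MajorizedTheory.
Variables (R : realType) (d : nat).
Implicit Types x y : d.-tuple R.

Lemma perm_decr_rearr x : perm_eq (decr_rearr x) x.
Proof. by rewrite perm_sort. Qed.

Lemma size_decr_rearr x : size (decr_rearr x) = d.
Proof. by rewrite size_sort size_tuple. Qed.

Lemma sorted_decr_rearr x : sorted >=%R (decr_rearr x).
Proof. by apply: sort_sorted => a b; exact: le_total. Qed.

Lemma decr_rearr_perm x y : perm_eq x y -> decr_rearr x = decr_rearr y.
Proof.
move=> /perm_sortP; apply.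
- by move=> a b; exact: le_total.
- exact: ge_trans.
- by move=> a b /andP[ba ab]; apply/le_anti/andP.
Qed.

Lemma decr_rearr_sum (F : R -> R) x :
  \sum_(z <- decr_rearr x) F z = \sum_(z <- x) F z.
Proof. exact/perm_big/perm_decr_rearr. Qed.

Lemma decr_rearr_head_total x :
  \sum_(0 <= j < d) (decr_rearr x)`_j = \sum_(z <- x) z.
Proof. by rewrite -(decr_rearr_sum id) [RHS](big_nth 0) size_decr_rearr. Qed.

Lemma tuple_sum (F : R -> R) x : \sum_(z <- x) F z = \sum_(i < d) F x`_i.
Proof. by rewrite (big_nth 0) size_tuple big_mkord. Qed.

Lemma majorized_total x y : majorized x y -> \sum_(z <- x) z = \sum_(z <- y) z.
Proof. by case=> _; rewrite !big_mkord -!(tuple_sum id). Qed.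

Lemma majorized_perm x x' y y' : perm_eq x x' -> perm_eq y y' ->
  majorized x y -> majorized x' y'.
Proof.
move=> px py [maj tot]; split.
  by rewrite -(decr_rearr_perm px) -(decr_rearr_perm py).
move: tot; rewrite !big_mkord -!(tuple_sum id).
by rewrite (perm_big _ px) (perm_big _ py).
Qed.

(** Excess sums ignore the order of the entries, so the bound of [head_sum_le] for [x], taken at the
    last level of the head, is the head sum of the rearrangement. *)
Lemma head_sum_decr_rearr x k : (k <= d)%N ->
  \sum_(0 <= j < k) x`_j <= \sum_(0 <= j < k) (decr_rearr x)`_j.
Proof.
case: k => [|k] kd; first by rewrite !big_nil.
rewrite (sorted_head_sum (sorted_decr_rearr x)) ?size_decr_rearr//.
by rewrite /excess_sum decr_rearr_sum head_sum_le// size_tuple.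
Qed.

Lemma majorized_excess x y :
  (forall t, excess_sum t y <= excess_sum t x) ->
  \sum_(z <- y) z = \sum_(z <- x) z -> majorized y x.
Proof.
move=> le_yx tot; split; last by rewrite !big_mkord -!(tuple_sum id).
case=> [//|k] /andP[_ kd]; have {}kd : (k < d)%N by lia.
rewrite (sorted_head_sum (sorted_decr_rearr x)) ?size_decr_rearr//.
set t := _`_k; apply: le_trans (head_sum_le t _) _; rewrite ?size_decr_rearr//.
by rewrite /excess_sum !decr_rearr_sum lerD2l; exact: le_yx.
Qed.

(** A version with slack [delta]; for states of the ball, [delta] will be [eps]. *)
Lemma head_sum_excess_le x y k delta : sorted >=%R x -> (0 < k <= d)%N ->
  (forall t, excess_sum t y <= excess_sum t x + delta) ->
  \sum_(0 <= j < k) (decr_rearr y)`_j <= \sum_(0 <= j < k) x`_j + delta.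
Proof.
case: k => [//|k] sx /andP[_ kd] le_yx.
rewrite (sorted_head_sum sx) ?size_tuple//.
set t := _`_k; apply: le_trans (head_sum_le t _) _; rewrite ?size_decr_rearr//.
by rewrite /excess_sum decr_rearr_sum -addrA lerD2l; exact: le_yx.
Qed.

(** The level is 0: the excess sum of nonnegative entries is their total. *)
Lemma head_sum_le_total x k : (forall i, (i < d)%N -> 0 <= x`_i) -> (k <= d)%N ->
  \sum_(0 <= j < k) (decr_rearr x)`_j <= \sum_(z <- x) z.
Proof.
move=> x0 kd; have -> : \sum_(z <- x) z = excess_sum 0 x.
  rewrite /excess_sum; apply: eq_big_seq => z xz.
  case/(nthP 0): xz => i; rewrite size_tuple => id <-.
  by rewrite excessE ?subr0// x0.
rewrite /excess_sum -decr_rearr_sum -[leRHS]add0r -[X in _ <= X + _](mul0rn _ k).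
by apply: head_sum_le; rewrite size_decr_rearr.
Qed.

Lemma majorized_anti x y : majorized x y -> majorized y x -> perm_eq x y.
Proof.
move=> maj [yx _]; have [xy _] := maj.
have eq_head k : (k <= d)%N ->
    \sum_(0 <= j < k) (decr_rearr x)`_j = \sum_(0 <= j < k) (decr_rearr y)`_j.
  move=> kd; have [->|k0] := posnP k; first by rewrite !big_nil.
  move: kd; rewrite leq_eqVlt => /predU1P[->|kd]; last first.
    by apply/le_anti/andP; split; [apply: xy|apply: yx]; lia.
  by rewrite !decr_rearr_head_total; exact: majorized_total.
have eq_sort : decr_rearr x = decr_rearr y.
  apply: (@eq_from_nth _ 0); first by rewrite !size_decr_rearr.
  move=> i; rewrite size_decr_rearr => id.
  have := eq_head i.+1 id.
  by rewrite !big_nat_recr//= (eq_head i (ltnW id)) => /addrI.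
by rewrite -(permPl (perm_decr_rearr x)) eq_sort perm_decr_rearr.
Qed.

(** With [a] and [b] the rearrangements of [y] and [x], [b^2 - a^2 = 2 a (b - a) + (b - a)^2], and
    the first terms have a nonnegative sum by summation by parts. *)
Lemma majorized_sqr x y : majorized y x ->
  \sum_(z <- y) z ^+ 2 <= \sum_(z <- x) z ^+ 2.
Proof.
move=> maj; have [yx _] := maj.
case: (posnP d) => [d0|d_gt0].
  by move: x y {yx maj}; rewrite d0 => x y; rewrite (tuple0 x) (tuple0 y).
rewrite -(decr_rearr_sum _ x) -(decr_rearr_sum _ y).
rewrite [leLHS](big_nth 0) [leRHS](big_nth 0) !size_decr_rearr.
pose a i := (decr_rearr y)`_i; pose b i := (decr_rearr x)`_i.
have sum_ab : \sum_(0 <= j < d) (b j - a j) = 0.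
  apply/eqP; rewrite sumrB subr_eq0; apply/eqP.
  by rewrite !decr_rearr_head_total; exact/esym/majorized_total.
have : 0 <= \sum_(0 <= j < d) a j * (b j - a j).
  have a_anti i : (i < d.-1)%N -> a i.+1 <= a i.
    by move=> id; apply: sorted_nth_ge; rewrite ?sorted_decr_rearr ?size_decr_rearr//; lia.
  have ab_head k : (k <= d.-1)%N -> 0 <= \sum_(0 <= j < k) (b j - a j).
    case: k => [|k] kd; first by rewrite big_nil.
    by rewrite sumrB subr_ge0 yx.
  by have := abel_sum_ge a_anti ab_head; rewrite prednK// sum_ab mulr0.
move=> ge0; rewrite -subr_ge0 -sumrB.
have : 0 <= \sum_(0 <= j < d) (b j - a j) ^+ 2 by apply: sumr_ge0 => i _; rewrite sqr_ge0.
move=> /(addr_ge0 (mulrn_wge0 2 ge0)); rewrite -sumrMnl -big_split/=.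
by congr (_ <= _); apply: eq_bigr => i _; rewrite /a /b; ring.
Qed.

End MajorizedTheory.

(** * The extremal spectra *)

Section ExtremalTuples.
Variable R : realType.

Lemma excess_sum_continuous (s : seq R) : continuous (fun a => excess_sum a s : R^o).
Proof.
elim: s => [|x s IH].
  rewrite (_ : (fun _ => _) = fun=> 0); first exact: cst_continuous.
  by apply/funext => a; rewrite /excess_sum big_nil.
rewrite (_ : (fun _ => _) = (fun a => excess a x + excess_sum a s : R^o)).
  move=> a; apply: (@cvgD _ R^o); last exact: IH.
  apply: (@continuous_max R R^o (fun=> 0) (fun a => x - a)); first exact: cst_continuous.
  by apply: (@cvgB _ R^o); [exact: cvg_cst|exact: cvg_id].
by apply/funext => a; rewrite /excess_sum big_cons.
Qed.

Lemma excess_sum_le_anti (s : seq R) a b : a <= b -> excess_sum b s <= excess_sum a s.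
Proof. by move=> ab; apply: ler_sum => x _; exact: excess_anti. Qed.

(** The excess sum is continuous and vanishes at [lo + excess_sum lo s], a level above every entry,
    so it takes the value [eps] in between. *)
Lemma excess_sum_ivt (s : seq R) lo eps : 0 <= eps <= excess_sum lo s ->
  exists2 a, lo <= a & excess_sum a s = eps.
Proof.
move=> /andP[eps0 eps_lo].
have lo_hi : lo <= lo + excess_sum lo s by rewrite lerDl (le_trans eps0).
have hi0 : excess_sum (lo + excess_sum lo s) s = 0.
  apply: big1_seq => x /= xs; apply: excess_eq0.
  rewrite -lerBlDl (le_trans (excess_ge _ _))// /excess_sum (big_rem x)//= lerDl.
  by apply: sumr_ge0 => z _; exact: excess_ge0.
have := @IVT R (fun a => excess_sum a s) lo (lo + excess_sum lo s) eps lo_hi.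
case.
- exact/continuous_subspaceT/excess_sum_continuous.
- by rewrite hi0 ge_min eps0 orbT le_max eps_lo.
- by move=> c; rewrite in_itv /= => /andP[loc _] fc; exists c.
Qed.

Variable d : nat.
Implicit Types mu q : d.-tuple R.

Lemma nth_tuple_ord (f : 'I_d -> R) i (id : (i < d)%N) :
  [tuple f j | j < d]`_i = f (Ordinal id).
Proof. exact: (nth_mktuple f 0 (Ordinal id)). Qed.

Lemma sum_const_tuple mu (c : R) : \sum_(x <- mu) c = c *+ d.
Proof. by rewrite big_const_seq count_predT size_tuple iter_addr_0. Qed.

Lemma dinv_sum : (0 < d)%N -> d%:R^-1 *+ d = 1 :> R.
Proof. by move=> d0; rewrite -[LHS]mulr_natr mulVf// pnatr_eq0 -lt0n. Qed.

(** The deviations from the mean [1/d] cancel. Hence a single threshold on [eps] governs the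
    existence of both levels. *)
Lemma deficit_sum_mean mu : (0 < d)%N -> \sum_(x <- mu) x = 1 ->
  excess_sum (- d%:R^-1) (map -%R mu) = excess_sum d%:R^-1 mu.
Proof.
move=> d0 mu1; rewrite /excess_sum big_map.
under eq_bigr do rewrite excess_oppE.
by rewrite sumrB sumrB mu1 sum_const_tuple dinv_sum// subrr subr0.
Qed.

(** * The two levels of the flattened spectrum *)

Section Levels.
Variables (eps : R) (mu : d.-tuple R).
Hypothesis mu_sorted : sorted >=%R mu.

Lemma mu_anti i j : (i <= j)%N -> (j < d)%N -> mu`_j <= mu`_i.
Proof. by move=> ij jd; apply: sorted_nth_ge; rewrite ?size_tuple. Qed.

(** Together with [deficit_sum_split], this translates the sums of absolute values in [lower_spec]
    and [raise_spec] into excess sums. *)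
Lemma excess_sum_split a k : (k <= d)%N ->
  (forall i, (i < k)%N -> a <= mu`_i) ->
  (forall i, (k <= i < d)%N -> mu`_i <= a) ->
  excess_sum a mu = \sum_(0 <= i < k) `|a - mu`_i|.
Proof.
move=> kd ge_a le_a; rewrite /excess_sum (big_nth 0) size_tuple (big_cat_nat (n := k))//=.
rewrite [X in _ + X]big_nat [X in _ + X]big1 ?addr0.
  apply: eq_big_nat => i /andP[_ ik]; rewrite excessE ?ge_a//.
  by rewrite distrC ger0_norm// subr_ge0 ge_a.
by move=> i /le_a; exact: excess_eq0.
Qed.

Lemma deficit_sum_split a k : (k <= d)%N ->
  (forall i, (i < k)%N -> a <= mu`_i) ->
  (forall i, (k <= i < d)%N -> mu`_i <= a) ->
  excess_sum (- a) (map -%R mu) = \sum_(k <= i < d) `|a - mu`_i|.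
Proof.
move=> kd ge_a le_a; rewrite /excess_sum big_map (big_nth 0) size_tuple (big_cat_nat (n := k))//=.
rewrite [X in X + _]big_nat [X in X + _]big1 ?add0r.
  apply: eq_big_nat => i iP; rewrite excessE ?lerN2 ?le_a// opprK addrC.
  by rewrite ger0_norm// subr_ge0 le_a.
by move=> i /andP[_ ik]; apply: excess_eq0; rewrite lerN2 ge_a.
Qed.

Lemma lower_spec_split b m : lower_spec eps mu (b, m) ->
  [/\ (m <= d)%N, forall i, (i < m)%N -> b < mu`_i,
      forall i, (m <= i < d)%N -> mu`_i <= b & excess_sum b mu = eps].
Proof.
move=> [_ md sum_eps /andP[mb bm]].
have gt_b i : (i < m)%N -> b < mu`_i.
  by move=> im; apply: (lt_le_trans bm); apply: mu_anti; lia.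
have le_b i : (m <= i < d)%N -> mu`_i <= b.
  by move=> /andP[mi id]; apply: le_trans mb; apply: mu_anti.
split=> //; first lia.
by rewrite (@excess_sum_split b m)//; [lia|move=> i /gt_b/ltW].
Qed.

Lemma raise_spec_split a n : raise_spec eps mu (a, n) ->
  [/\ (d - n <= d)%N, forall i, (i < d - n)%N -> a <= mu`_i,
      forall i, (d - n <= i < d)%N -> mu`_i < a
    & excess_sum (- a) (map -%R mu) = eps].
Proof.
move=> [_ nd sum_eps /andP[na an]].
have ge_a i : (i < d - n)%N -> a <= mu`_i.
  by move=> im; apply: (le_trans an); apply: mu_anti; lia.
have lt_a i : (d - n <= i < d)%N -> mu`_i < a.
  by move=> /andP[mi id]; apply: le_lt_trans na; apply: mu_anti.
split=> //; first lia.
by rewrite (@deficit_sum_split a (d - n))//; [lia|move=> i /lt_a/ltW].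
Qed.

Hypothesis d_ge2 : (2 <= d)%N.
Hypothesis mu_ge0 : forall i, (i < d)%N -> 0 <= mu`_i.
Hypothesis mu_sum : \sum_(x <- mu) x = 1.
Hypothesis eps_gt0 : 0 < eps.
Let d_gt0 : (0 < d)%N. Proof. exact: leq_trans d_ge2. Qed.
Hypothesis eps_lt : eps < excess_sum d%:R^-1 mu.

Lemma mu_le1 i : (i < d)%N -> mu`_i <= 1.
Proof.
move=> id; rewrite -mu_sum (big_rem mu`_i)/=; last by rewrite mem_nth// size_tuple.
rewrite lerDl big_seq; apply: sumr_ge0 => x /mem_rem.
by case/(nthP 0) => j; rewrite size_tuple => /mu_ge0 + <-.
Qed.

Lemma lower_spec_ex : exists p, lower_spec eps mu p.
Proof.
have [|b db sum_b] := @excess_sum_ivt mu d%:R^-1 eps.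
  by rewrite (ltW eps_gt0) (ltW eps_lt).
have {}db : d%:R^-1 < b.
  by rewrite lt_neqAle db andbT; apply: contraPneq eps_lt => ->; rewrite sum_b ltxx.
(* [m] counts the entries strictly above [b]. It is below [d], since otherwise the total would
   exceed 1, and positive, since an empty sum would give [eps = 0]. *)
pose m := find (fun x => x <= b) mu.
have gt_b i : (i < m)%N -> b < mu`_i.
  by move=> /(before_find 0) /negbT; rewrite -ltNge.
have md : (m < d)%N.
  rewrite ltnNge; apply/negP => dm.
  have : \sum_(x <- mu) d%:R^-1 < \sum_(x <- mu) x.
    rewrite !(tuple_sum (fun x => x)) (tuple_sum (fun=> d%:R^-1)).
    apply: ltr_sum => [|i _]; last by apply: (lt_trans db); apply: gt_b; exact: leq_trans dm.
    by apply/hasP; exists (Ordinal d_ge2); rewrite ?mem_index_enum.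
  by rewrite sum_const_tuple dinv_sum// mu_sum ltxx.
have mb : mu`_m <= b by apply: (@nth_find _ 0 (fun x => x <= b)); rewrite has_find size_tuple.
have le_b i : (m <= i < d)%N -> mu`_i <= b.
  by move=> /andP[mi id]; apply: le_trans mb; apply: mu_anti.
have sum_eps : \sum_(0 <= i < m) `|b - mu`_i| = eps.
  by rewrite -excess_sum_split// => [|i /gt_b/ltW//]; exact: ltnW.
have m0 : (0 < m)%N.
  by rewrite lt0n; apply: contraPneq eps_gt0 => m0; rewrite -sum_eps m0 big_nil ltxx.
have bm : b < mu`_m.-1 by apply: gt_b; lia.
exists (b, m); split=> //; last by rewrite mb bm.
- rewrite (le_trans _ (ltW db)) ?invr_ge0 ?ler0n//= (le_trans (ltW bm))// mu_le1//; lia.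
- lia.
Qed.

(** The argument for the lower pair, applied to the negated spectrum. *)
Lemma raise_spec_ex : exists p, raise_spec eps mu p.
Proof.
have [|t dt sum_t] := @excess_sum_ivt (map -%R mu) (- d%:R^-1) eps.
  by rewrite deficit_sum_mean// (ltW eps_gt0) (ltW eps_lt).
pose a := - t; have tE : t = - a by rewrite opprK.
move: dt sum_t; rewrite tE lerN2 => ad sum_a.
have {}ad : a < d%:R^-1.
  rewrite lt_neqAle ad andbT; apply: contraPneq eps_lt => ad'.
  by rewrite -(deficit_sum_mean d_gt0 mu_sum) -ad' sum_a ltxx.
(* [k] counts the entries that are at least [a] and stands for [d - n]; here ties with the level are
   left outside the raised block. *)
pose k := find (fun x => x < a) mu.
have ge_a i : (i < k)%N -> a <= mu`_i.
  by move=> /(before_find 0) /negbT; rewrite -leNgt.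
have k_le : (k <= d)%N by rewrite -[X in (_ <= X)%N](size_tuple mu) find_size.
have lt_a i : (k <= i < d)%N -> mu`_i < a.
  move=> /andP[ki id].
  have : mu`_k < a.
    by apply: (@nth_find _ 0 (fun x => x < a)); rewrite has_find size_tuple (leq_ltn_trans ki).
  by apply: le_lt_trans; apply: mu_anti.
have sum_eps : \sum_(k <= i < d) `|a - mu`_i| = eps.
  by rewrite -deficit_sum_split// => i /lt_a/ltW.
have kd : (k < d)%N.
  rewrite ltn_neqAle k_le andbT; apply: contraPneq eps_gt0 => kd.
  by rewrite -sum_eps kd big_geq// ltxx.
have k0 : (0 < k)%N.
  rewrite lt0n; apply/eqP => k0.
  have : \sum_(x <- mu) x < \sum_(x <- mu) d%:R^-1.
    rewrite (tuple_sum (fun x => x)) (tuple_sum (fun=> d%:R^-1)).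
    apply: ltr_sum => [|i _]; last by apply: lt_trans ad; apply: lt_a; rewrite k0/=.
    by apply/hasP; exists (Ordinal d_ge2); rewrite ?mem_index_enum.
  by rewrite sum_const_tuple dinv_sum// mu_sum ltxx.
have dk : (d - (d - k))%N = k by rewrite subKn.
exists (a, (d - k)%N); split; rewrite ?dk//.
- rewrite (le_trans (mu_ge0 kd))/=; last by apply: ltW; apply: lt_a; rewrite leqnn.
  by rewrite (le_trans (ltW ad))// invf_le1 ?ler1n ?ltr0n; lia.
- lia.
- by rewrite lt_a ?leqnn// ge_a//; lia.
Qed.

(** Once a pair exists, [get] returns one meeting the specification. Monotonicity of the excess sums
    puts [1/d] between the levels, and the three cases of [flattened] become those of [clamp]. *)
Lemma flattened_clamp : exists a b,
  [/\ a <= d%:R^-1 <= b, excess_sum b mu = eps,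
      excess_sum (- a) (map -%R mu) = eps
    & forall i, (i < d)%N -> (flattened eps mu)`_i = clamp a b mu`_i].
Proof.
have := getPex lower_spec_ex; have := getPex raise_spec_ex.
rewrite /flattened /raise_pair /lower_pair.
case: (get _) => a n; case: (get _) => b m /=.
move=> /raise_spec_split[nd ge_a lt_a sum_a] /lower_spec_split[md gt_b le_b sum_b].
have ad : a <= d%:R^-1.
  rewrite leNgt; apply/negP => da; move: eps_lt; rewrite -(deficit_sum_mean d_gt0 mu_sum) -sum_a.
  by apply/negP; rewrite -leNgt excess_sum_le_anti// lerN2 ltW.
have db : d%:R^-1 <= b.
  rewrite leNgt; apply/negP => bd; move: eps_lt; rewrite -sum_b.
  by apply/negP; rewrite -leNgt excess_sum_le_anti// ltW.
exists a, b; split; rewrite ?ad ?db// => i id; rewrite nth_tuple_ord /= /clamp.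
have ab := le_trans ad db.
case: ltnP => im; first by rewrite min_l ?max_r// ltW// gt_b.
have mub : mu`_i <= b by rewrite le_b// im.
rewrite min_r//; case: ltnP => in_; first by rewrite max_r// ge_a.
by rewrite max_l// ltW// lt_a// in_.
Qed.

End Levels.
End ExtremalTuples.

(** * The steepened spectrum *)

Section Steepened.
Variables (R : realType) (d : nat) (eps : R) (q : d.-tuple R).
Hypothesis d_ge2 : (2 <= d)%N.
Hypothesis q_ge0 : forall i, (i < d)%N -> 0 <= q`_i.
Hypothesis q_sum : \sum_(0 <= i < d) q`_i = 1.
Hypothesis eps_gt0 : 0 < eps.

Lemma head_sum_shift (a c : nat -> R) n k :
  a 0%N = c 0%N + eps -> (forall i, (0 < i < n)%N -> a i = c i) -> (0 < k <= n)%N ->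
  \sum_(0 <= j < k) a j = \sum_(0 <= j < k) c j + eps.
Proof.
move=> a0 ac /andP[k0 kn]; rewrite !(big_ltn k0) a0 addrAC; congr (_ + _ + _).
by apply: eq_big_nat => i /andP[i0 ik]; apply: ac; lia.
Qed.

Lemma sum_nat_last (F : nat -> R) n : (0 < n)%N ->
  \sum_(0 <= j < n) F j = \sum_(0 <= j < n.-1) F j + F n.-1.
Proof. by case: n => // n _; rewrite big_nat_recr. Qed.

Lemma tail_sumE l : (l <= d)%N -> tail_sum q l = 1 - \sum_(0 <= j < d - l) q`_j.
Proof.
move=> ld; apply/eqP; rewrite eq_sym subr_eq addrC -q_sum /tail_sum.
by rewrite -big_cat_nat ?leq_subr.
Qed.

Lemma tail_sumS l : (l < d)%N -> tail_sum q l.+1 = q`_(d - l).-1 + tail_sum q l.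
Proof.
move=> ld; rewrite /tail_sum big_ltn; last by lia.
have dl : (d - l.+1).+1 = (d - l)%N by lia.
by rewrite dl subnS.
Qed.

(** The facts about the three cases of the definition that are used later: the first clause gives a
    state, the next two bound its distance to [sigma], the fourth places it on the boundary, and the
    last says that head sums are at least [min 1 (S_k + eps)]. *)
Lemma steepened_spec (p := steepened eps q) :
  [/\ (forall i, (i < d)%N -> 0 <= p`_i) /\ \sum_(0 <= i < d) p`_i = 1,
      p`_0 <= q`_0 + eps,
      forall i, (0 < i < d)%N -> p`_i <= q`_i,
      p`_0 = q`_0 + eps \/ p`_d.-1 = 0
    & forall k, (0 < k < d)%N ->
        \sum_(0 <= j < k) q`_j + eps <= \sum_(0 <= j < k) p`_j \/
        1 <= \sum_(0 <= j < k) p`_j].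
Proof.
have d0 : (0 < d)%N by lia.
rewrite {}/p /steepened; case: ifPn => [eps_lt|].
  set p := [tuple _ | _ < _].
  have p0 : p`_0 = q`_0 + eps by rewrite /p (nth_tuple_ord _ d0).
  have plast : p`_d.-1 = q`_d.-1 - eps.
    have id : (d.-1 < d)%N by lia.
    by rewrite /p (nth_tuple_ord _ id) /= eqxx ifN//; lia.
  have pmid i : (0 < i < d.-1)%N -> p`_i = q`_i.
    move=> iP; have id : (i < d)%N by lia.
    by rewrite /p (nth_tuple_ord _ id) /= !ifN//; lia.
  have phead k : (0 < k < d)%N ->
      \sum_(0 <= j < k) p`_j = \sum_(0 <= j < k) q`_j + eps.
    by move=> kP; apply: (head_sum_shift p0 pmid); lia.
  have casei i : (i < d)%N -> [\/ i = 0%N, i = d.-1 | (0 < i < d.-1)%N].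
    move=> id; have [->|i0] := eqVneq i 0%N; first exact: Or31.
    by have [->|i1] := eqVneq i d.-1; [exact: Or32|apply: Or33; lia].
  split.
  - split=> [i id|].
      case: (casei _ id) => [->|->|iP]; first by rewrite p0 addr_ge0 ?q_ge0// ltW.
        by rewrite plast subr_ge0 ltW.
      by rewrite pmid// q_ge0.
    rewrite sum_nat_last// phead; last lia.
    by rewrite plast addrACA subrr addr0 -q_sum -sum_nat_last.
  - by rewrite p0.
  - move=> i iP; case: (casei i _) => [|i0|->|iP']; [lia|lia| |].
      by rewrite plast lerBlDr lerDl ltW.
    by rewrite pmid.
  - by left.
  - by move=> k kP; left; rewrite phead.
rewrite -leNgt => last_le.
set l := (\max_(_ < _ | _) _)%N.
have [l_gt0 l_le l_max] : [/\ (0 < l < d)%N, tail_sum q l <= eps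
    & forall l', (0 < l' < d)%N -> tail_sum q l' <= eps -> (l' <= l)%N].
  (* [Ordinal d_ge2] is the index 1, whose tail sum is the last entry. It shows that the maximum
     defining [l] is attained and is not the default 0. *)
  have P1 : (0 < Ordinal d_ge2)%N && (tail_sum q (Ordinal d_ge2) <= eps).
    rewrite /= tail_sumS// subn0 /tail_sum subn0 big_geq// addr0.
    by [].
  split=> [||l' /andP[l'0 l'd] tl'].
  - rewrite /l (bigop.bigmax_eq_arg (Ordinal d_ge2)) //.
    by case: arg_maxnP => // i /andP[i0 _] _; rewrite i0 ltn_ord.
  - rewrite /l (bigop.bigmax_eq_arg (Ordinal d_ge2)) //.
    by case: arg_maxnP => // i /andP[].
  - by apply: (leq_bigmax_cond (Ordinal l'd)); rewrite l'0.
have [ld1|ld1] := eqVneq l d.-1.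
  set p := [tuple _ | _ < _].
  have p0 : p`_0 = 1 by rewrite /p (nth_tuple_ord _ d0).
  have pS i : (0 < i < d)%N -> p`_i = 0.
    move=> iP; have id : (i < d)%N by lia.
    by rewrite /p (nth_tuple_ord _ id) /= ifN//; lia.
  have phead k : (0 < k <= d)%N -> \sum_(0 <= j < k) p`_j = 1.
    move=> kP; rewrite big_ltn ?p0; last lia.
    by rewrite big_nat big1 ?addr0// => i iP; apply: pS; lia.
  split.
  - split=> [i id|]; last by apply: phead; lia.
    by case: i id => [|i] id; [rewrite p0|rewrite pS].
  - rewrite p0; move: l_le; rewrite ld1 tail_sumE ?leq_pred//.
    have -> : (d - d.-1 = 1)%N by lia.
    by rewrite big_nat1 lerBlDl.
  - by move=> i iP; rewrite pS// q_ge0//; lia.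
  - by right; apply: pS; lia.
  - by move=> k kP; right; rewrite phead//; lia.
set p := [tuple _ | _ < _].
have tail_gt : eps < tail_sum q l.+1.
  rewrite ltNge; apply/negP => tl; have := l_max l.+1 _ tl.
  by rewrite ltnn; lia.
(* The position, counted from 0, of the entry that is only partly emptied. *)
pose L := (d - l).-1.
have Lpos : (0 < L)%N by rewrite /L; lia.
have Ld : (L < d.-1)%N by rewrite /L; lia.
have p0 : p`_0 = q`_0 + eps by rewrite /p (nth_tuple_ord _ d0).
have pmid i : (0 < i < L)%N -> p`_i = q`_i.
  move=> iP; have id : (i < d)%N by lia.
  rewrite /p (nth_tuple_ord _ id) /= ifN; last by lia.
  by rewrite ifT//; move: iP; rewrite /L; lia.
have pL : p`_L = q`_L - (eps - tail_sum q l).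
  have id : (L < d)%N by lia.
  rewrite /p (nth_tuple_ord _ id) /= ifN; last by lia.
  by rewrite ltnn eqxx.
have pend i : (L < i < d)%N -> p`_i = 0.
  move=> iP; have id : (i < d)%N by lia.
  rewrite /p (nth_tuple_ord _ id) /= ifN; last by lia.
  by rewrite !ifN//; move: iP; rewrite /L; lia.
have phead k : (0 < k <= L)%N ->
    \sum_(0 <= j < k) p`_j = \sum_(0 <= j < k) q`_j + eps.
  by move=> kP; apply: (head_sum_shift p0 pmid).
(* The amount removed from position [L] and from the tail is exactly the [eps] added in front, so
   the total 1 is reached at [L]. *)
have pfull k : (L < k <= d)%N -> \sum_(0 <= j < k) p`_j = 1.
  move=> kP; rewrite (big_cat_nat (n := L.+1))//=; last lia.
  rewrite [X in _ + X]big_nat [X in _ + X]big1 ?addr0; last by move=> i iP; apply: pend; lia.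
  rewrite big_nat_recr//= phead ?Lpos ?leqnn// pL.
  have := @tail_sumE l; have -> : (d - l = L.+1)%N by rewrite /L; lia.
  by rewrite big_nat_recr//= => ->; [lra|lia].
move: tail_gt; rewrite tail_sumS -/L; last lia.
move=> tail_gt.
have casei i : (i < d)%N -> [\/ i = 0%N, (0 < i < L)%N, i = L | (L < i)%N].
  move=> id; have [->|i0] := posnP i; first exact: Or41.
  by have [iL|Li|->] := ltngtP i L; [apply: Or42; apply/andP|exact: Or44|exact: Or43].
split.
- split=> [i id|]; last by apply: pfull; lia.
  case: (casei _ id) => [->|iP|->|iP].
  + by rewrite p0 addr_ge0 ?q_ge0// ltW.
  + by rewrite pmid// q_ge0.
  + by rewrite pL; lra.
  + by rewrite pend// iP.
- by rewrite p0.
- move=> i /andP[i0 id]; case: (casei _ id) => [i0'|iP|->|iP].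
  + by move: i0; rewrite i0'.
  + by rewrite pmid.
  + by rewrite pL; lra.
  + by rewrite pend ?iP// q_ge0.
- by left.
- move=> k /andP[k0 kd]; have [kL|Lk] := leqP k L; [left|right].
    by rewrite phead// k0.
  by rewrite pfull ?Lk ?(ltnW kd).
Qed.

End Steepened.

(** * Trace distance and spectra *)

Section DiagonalOperators.
Local Open Scope sesquilinear_scope.
Variables (R : realType) (d : nat).
Local Notation C := R[i].
Implicit Types (A B : 'M[C]_d) (e u : 'I_d -> 'cV[C]_d) (x y : d.-tuple R).

Definition basis_mx e : 'M[C]_d := \matrix_(i, j) e j i 0.

Definition real_diag x : 'M[C]_d := diag_mx (\row_i (x`_i)%:C).

Lemma basis_mxE e : orthonormal_basis e -> (basis_mx e)^t* *m basis_mx e = 1%:M.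
Proof.
move=> oe; apply/matrixP => i j; rewrite mxE [RHS]mxE -(oe i j) mxE.
by apply: eq_bigr => k _; rewrite !mxE.
Qed.

Lemma basis_mx_unitary e : orthonormal_basis e -> basis_mx e \is unitarymx.
Proof. by move=> oe; apply/unitarymxP/mulmx1C/basis_mxE. Qed.

Lemma diag_opE e x : diag_op e x = basis_mx e *m real_diag x *m (basis_mx e)^t*.
Proof.
apply/matrixP => i j; rewrite /diag_op summxE mxE; apply: eq_bigr => k _.
rewrite mul_mx_diag !mxE big_ord1 !mxE /=; ring.
Qed.

Lemma trC_mul (m n p : nat) (A : 'M[C]_(m, n)) (B : 'M[C]_(n, p)) :
  (A *m B)^t* = B^t* *m A^t*.
Proof. by rewrite trmx_mul map_mxM. Qed.

Lemma real_complexJ (r : R) : (r%:C)^*%R = r%:C.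
Proof. by apply: conj_Creal; apply/complex_realP; exists r. Qed.

Lemma real_diag_trC x : (real_diag x)^t* = real_diag x.
Proof.
apply/matrixP => i j; rewrite !mxE eq_sym; case: eqVneq => [->|_] /=.
  by rewrite !mulr1n real_complexJ.
by rewrite !mulr0n conjC0.
Qed.

Lemma hermsymP A : reflect (A = A^t*) (A \is hermsymmx).
Proof. by apply: (iffP (is_hermitianmxP _ _ _)); rewrite expr0 scale1r. Qed.

Lemma diag_op_herm e x : diag_op e x \is hermsymmx.
Proof.
by apply/hermsymP; rewrite diag_opE !trC_mul real_diag_trC trmxCK mulmxA.
Qed.

Lemma char_poly_similar (n : nat) (P D Q : 'M[C]_n) : Q *m P = 1%:M ->
  char_poly (P *m D *m Q) = char_poly D.
Proof.
move=> QP; have PQ := mulmx1C QP.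
rewrite /char_poly /char_poly_mx !map_mxM.
have QP' : map_mx polyC Q *m map_mx polyC P = 1%:M :> 'M[{poly C}]_n.
  by rewrite -map_mxM QP map_mx1.
have PQ' := mulmx1C QP'.
have XE : ('X%:M : 'M[{poly C}]_n) = map_mx polyC P *m 'X%:M *m map_mx polyC Q.
  by rewrite scalar_mxC -mulmxA PQ' mulmx1.
by rewrite [in LHS]XE -mulmxBl -mulmxBr !det_mulmx mulrAC -det_mulmx PQ' det1 mul1r.
Qed.

Lemma char_poly_diag (n : nat) (v : 'rV[C]_n) :
  char_poly (diag_mx v) = \prod_(z <- [seq v 0 i | i <- enum 'I_n]) ('X - z%:P).
Proof.
rewrite char_poly_trig ?diag_mx_is_trig// big_map big_enum /=.
by apply: eq_bigr => i _; rewrite mxE eqxx mulr1n.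
Qed.

(** Both diagonalizations have the characteristic polynomial of the same operator, and its linear
    factors determine the eigenvalues up to order. *)
Lemma spectral_diag_perm e x :
  orthonormal_basis e ->
  perm_eq [seq spectral_diag (diag_op e x) 0 i | i <- enum 'I_d]
          [seq (x`_i)%:C | i : 'I_d <- enum 'I_d].
Proof.
move=> oe; apply: prod_XsubC_eq; rewrite -char_poly_diag.
have /orthomx_spectralP AE := hermitian_normalmx (diag_op_herm e x).
have uP := spectral_unit (diag_op e x).
rewrite -(char_poly_similar _ (mulmxV uP)) -AE diag_opE.
rewrite char_poly_similar ?basis_mxE// /real_diag char_poly_diag.
by congr (\prod_(z <- _) _); apply: eq_map => i; rewrite mxE.
Qed.

Lemma perm_spectrum e x : orthonormal_basis e -> perm_eq (spectrum (diag_op e x)) x.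
Proof.
move=> oe; have := perm_map (@complex.Re R) (spectral_diag_perm x oe).
congr (perm_eq _ _); first by rewrite -map_comp.
apply: (@eq_from_nth _ 0); first by rewrite 2!size_map size_enum_ord size_tuple.
move=> i; rewrite 2!size_map size_enum_ord => id.
rewrite -map_comp (nth_map (Ordinal id)) ?size_enum_ord//=.
by rewrite nth_enum_ord.
Qed.

Lemma herm_diag_op A : A \is hermsymmx ->
  exists2 u, orthonormal_basis u & A = diag_op u (spectrum A).
Proof.
move=> hA; have /orthomx_spectralP AE := hermitian_normalmx hA.
have uP := spectral_unitarymx A.
set P := spectralmx A in AE uP.
(* [A] equals [invmx P *m D *m P] with [D] diagonal and [P] unitary, so the eigenvectors are the
   adjoints of the rows of [P]. *)
pose u (i : 'I_d) : 'cV[C]_d := (row i P)^t*.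
have uE : basis_mx u = P^t* by apply/matrixP => i j; rewrite !mxE.
exists u.
  move=> i j; move/unitarymxP: uP => /matrixP/(_ i j); rewrite !mxE => <-.
  by apply: eq_bigr => k _; rewrite !mxE conjCK.
rewrite diag_opE uE.
rewrite trmxCK.
rewrite -(invmx_unitary uP).
rewrite [LHS]AE.
congr (_ *m _ *m _).
rewrite /real_diag; congr diag_mx; apply/rowP => i; rewrite mxE nth_mktuple.
have /mxOverP/(_ 0 i) := hermitian_spectral_diag_real hA.
by case: (spectral_diag A 0 i) => a b /complex_realP[c [-> ->]].
Qed.

End DiagonalOperators.

(** * Diagonals in orthonormal bases, trace norm and Hilbert-Schmidt norm *)

Section QuadraticForm.
Local Open Scope sesquilinear_scope.
Variables (R : realType) (d : nat).
Local Notation C := R[i].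
Implicit Types (A B : 'M[C]_d) (e u : 'I_d -> 'cV[C]_d) (x y : d.-tuple R).

Definition qform A (v : 'cV[C]_d) : R := complex.Re ((v^t* *m A *m v) 0 0).

Definition coef e (v : 'cV[C]_d) (j : 'I_d) : C := ((e j)^t* *m v) 0 0.

(** The squared modulus of the coefficient, as an element of [R]. Between two orthonormal bases
    these numbers form a doubly stochastic matrix. *)
Definition weight e v j : R := complex.Re (coef e v j) ^+ 2 + complex.Im (coef e v j) ^+ 2.

Lemma weight_ge0 e v j : 0 <= weight e v j.
Proof. by rewrite addr_ge0// sqr_ge0. Qed.

Lemma weightE e v j : (weight e v j)%:C = `|coef e v j| ^+ 2.
Proof. exact: add_Re2_Im2. Qed.

Lemma coefJ (v w : 'cV[C]_d) : (w^t* *m v) 0 0 = ((v^t* *m w) 0 0)^*%R.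
Proof.
rewrite !mxE rmorph_sum /=; apply: eq_bigr => k _.
by rewrite !mxE rmorphM /= conjCK mulrC.
Qed.

Lemma weightC e u i j : weight e (u i) j = weight u (e j) i.
Proof.
by apply: (@complexI R); rewrite !weightE /coef coefJ norm_conjC.
Qed.

Lemma form_diag_op e x (v : 'cV[C]_d) :
  (v^t* *m diag_op e x *m v) 0 0 = (\sum_j weight e v j * x`_j)%:C.
Proof.
rewrite /diag_op mulmx_sumr mulmx_suml summxE raddf_sum /=.
apply: eq_bigr => j _; rewrite -scalemxAr -scalemxAl mxE rmorphM /= mulrC weightE.
congr (_ * _).
have -> : v^t* *m (e j *m (e j)^t*) *m v = (v^t* *m e j) *m ((e j)^t* *m v).
  by rewrite !mulmxA.
by rewrite mxE big_ord1 (coefJ (e j) v) normCK mulrC.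
Qed.

Lemma qform_diag_op e x v : qform (diag_op e x) v = \sum_j weight e v j * x`_j.
Proof. by rewrite /qform form_diag_op. Qed.

Lemma weight_eigen e i j : orthonormal_basis e -> weight e (e i) j = (j == i)%:R.
Proof.
move=> oe; rewrite /weight /coef oe; case: eqP => _ /=; first by rewrite expr1n expr0n addr0.
by rewrite !expr0n addr0.
Qed.

Lemma qform_eigen e x i : orthonormal_basis e -> qform (diag_op e x) (e i) = x`_i.
Proof.
move=> oe; rewrite qform_diag_op (bigD1 i)//= big1 ?addr0.
  by rewrite weight_eigen// eqxx mul1r.
by move=> j /negbTE ji; rewrite weight_eigen// ji mul0r.
Qed.

Lemma qformD A B v : qform (A + B) v = qform A v + qform B v.
Proof. by rewrite /qform mulmxDr mulmxDl mxE raddfD. Qed.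

Lemma diag_op_const e (c : R) : orthonormal_basis e ->
  diag_op e [tuple c | i < d] = c%:C%:M.
Proof.
move=> oe; rewrite diag_opE (_ : real_diag _ = c%:C%:M).
  rewrite -mulmxA mul_scalar_mx -scalemxAr.
  by rewrite (mulmx1C (basis_mxE oe)) scalemx1.
apply/matrixP => i j; rewrite !mxE.
by congr (_ *+ _); rewrite nth_mktuple.
Qed.

(** The quadratic form of the identity, expanded in the basis [e] and evaluated at the unit vector
    [u i]. *)
Lemma weight_row e u i : orthonormal_basis e -> orthonormal_basis u ->
  \sum_j weight e (u i) j = 1.
Proof.
move=> oe ou; have := qform_diag_op e [tuple 1 | i < d] (u i).
rewrite diag_op_const// /qform mulmx1 ou eqxx /= => ->.
by apply: eq_bigr => j _; rewrite nth_mktuple mulr1.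
Qed.

Lemma weight_col e u j : orthonormal_basis e -> orthonormal_basis u ->
  \sum_i weight e (u i) j = 1.
Proof.
by move=> oe ou; under eq_bigr do rewrite weightC; exact: weight_row.
Qed.

Lemma trace_qform u A : orthonormal_basis u ->
  \sum_i qform A (u i) = complex.Re (\tr A).
Proof.
move=> ou.
have -> : \tr A = \tr ((basis_mx u)^t* *m A *m basis_mx u).
  by rewrite mxtrace_mulC mulmxA (mulmx1C (basis_mxE ou)) mul1mx.
rewrite /mxtrace raddf_sum /=; apply: eq_bigr => i _; rewrite /qform.
congr complex.Re; rewrite -!mulmxA !mxE; apply: eq_bigr => k _; rewrite !mxE.
by congr (_ * _); apply: eq_bigr => l _; rewrite !mxE.
Qed.

Lemma trace_diag_op e x : orthonormal_basis e ->
  \tr (diag_op e x) = (\sum_(z <- x) z)%:C.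
Proof.
move=> oe; rewrite diag_opE mxtrace_mulC mulmxA basis_mxE// mul1mx mxtrace_diag.
by rewrite (tuple_sum id) raddf_sum; apply: eq_bigr => i _; rewrite mxE.
Qed.

Lemma excess_sum_qform t e u x : orthonormal_basis e -> orthonormal_basis u ->
  \sum_i excess t (qform (diag_op e x) (u i)) <= excess_sum t x.
Proof.
move=> oe ou; rewrite /excess_sum tuple_sum.
under eq_bigr do rewrite qform_diag_op.
apply: (@excess_average _ t 'I_d 'I_d (fun i j => weight e (u i) j) (fun j => x`_j)).
- by move=> i j; exact: weight_ge0.
- by move=> i; exact: weight_row.
- by move=> j; exact: weight_col.
Qed.

(** In the eigenbasis of the sum the diagonal is the spectrum [x]. There the excess splits by
    subadditivity, and each diagonal is compared with its own spectrum. *)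
Lemma excess_sumD t e e1 e2 x x1 x2 :
  orthonormal_basis e -> orthonormal_basis e1 -> orthonormal_basis e2 ->
  diag_op e x = diag_op e1 x1 + diag_op e2 x2 ->
  excess_sum t x <= excess_sum t x1 + excess_sum 0 x2.
Proof.
move=> oe oe1 oe2 xE; rewrite /excess_sum tuple_sum.
under eq_bigr => i _ do rewrite -(qform_eigen x i oe) xE qformD.
apply: le_trans (excess_sum_shiftD _ _ _) _.
by apply: lerD; exact: excess_sum_qform.
Qed.

(** An absolute value is twice the positive part minus the number itself. The subtracted terms give
    the trace on both sides, so only excesses at 0 have to be compared. *)
Lemma norm_qform e u x : orthonormal_basis e -> orthonormal_basis u ->
  \sum_i `|qform (diag_op e x) (u i)| <= \sum_(z <- x) `|z|.
Proof.
move=> oe ou; under eq_bigr do rewrite norm_excess.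
under [leRHS]eq_bigr do rewrite norm_excess.
rewrite !sumrB !sumrMnl trace_qform// trace_diag_op//= lerD2r lerMn2r /=.
exact: excess_sum_qform.
Qed.

Lemma conj_mulmx (P Q U D D' : 'M[C]_d) : Q^t* *m Q = 1%:M ->
  (P *m D *m Q^t*) *m (Q *m D' *m U) = P *m (D *m D') *m U.
Proof. by move=> QQ; rewrite !mulmxA -(mulmxA (P *m D)) QQ mulmx1. Qed.

Lemma real_diag_sqr x :
  real_diag x *m real_diag x = real_diag [tuple x`_i ^+ 2 | i < d].
Proof.
rewrite /real_diag mulmx_diag; congr diag_mx; apply/rowP => i.
by rewrite !mxE nth_mktuple -rmorphM expr2.
Qed.

Lemma diag_op_trC_mul e x : orthonormal_basis e ->
  (diag_op e x)^t* *m diag_op e x = diag_op e [tuple x`_i ^+ 2 | i < d].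
Proof.
move=> oe; move/hermsymP: (diag_op_herm e x) => <-.
by rewrite !diag_opE conj_mulmx ?real_diag_sqr ?basis_mxE.
Qed.

(** The eigenbasis chosen inside [sqrtmx] may differ from [e], but the trace only sees the
    eigenvalues up to order. *)
Lemma trace_norm_diag_op e x : orthonormal_basis e ->
  trace_norm (diag_op e x) = \sum_(z <- x) `|z|.
Proof.
move=> oe; rewrite /trace_norm /absmx diag_op_trC_mul//.
set y := [tuple _ | _ < _]; rewrite /sqrtmx.
rewrite -mulmxA mxtrace_mulC -mulmxA mulmxV ?spectral_unit// mulmx1 mxtrace_diag.
have -> : \sum_i map_mx sqrtC (spectral_diag (diag_op e y)) 0 i =
    \sum_(z <- [seq spectral_diag (diag_op e y) 0 i | i <- enum 'I_d]) sqrtC z.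
  by rewrite big_map big_enum /=; apply: eq_bigr => i _; rewrite mxE.
rewrite (perm_big _ (spectral_diag_perm y oe)) big_map big_enum /= raddf_sum tuple_sum.
apply: eq_bigr => i _; rewrite nth_mktuple rmorphXn /= -[LHS]/(complex.Re _).
(* The square is rewritten with a nonnegative base, because [sqrtC] returns the nonnegative root. *)
have -> : (x`_i)%:C ^+ 2 = (`|x`_i|%:C) ^+ 2 by rewrite -!rmorphXn /= real_normK ?num_real.
by rewrite sqrCK// ler0c.
Qed.

Lemma trace_normN A : trace_norm (- A) = trace_norm A.
Proof.
rewrite /trace_norm /absmx; have -> : (- A)^t* = - A^t*.
  by apply/matrixP => i j; rewrite !mxE rmorphN.
by rewrite mulNmx mulmxN opprK.
Qed.

Lemma trace_distC A B : trace_dist A B = trace_dist B A.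
Proof. by rewrite /trace_dist -trace_normN opprB. Qed.

Lemma hermsymD A B : A \is hermsymmx -> B \is hermsymmx -> A + B \is hermsymmx.
Proof.
move=> /hermsymP hA /hermsymP hB; apply/hermsymP.
by rewrite linearD /= map_mxD -hA -hB.
Qed.

Lemma hermsymZ (a : R) A : A \is hermsymmx -> a%:C *: A \is hermsymmx.
Proof.
move=> /hermsymP hA; apply/hermsymP.
by rewrite linearZ /= map_mxZ /= real_complexJ -hA.
Qed.

Lemma hermsymB A B : A \is hermsymmx -> B \is hermsymmx -> A - B \is hermsymmx.
Proof.
move=> hA /(@hermsymZ (-1)); rewrite rmorphN rmorph1 scaleN1r; exact: hermsymD.
Qed.

(** In an eigenbasis of [A + B] its trace norm is the sum of the absolute diagonal entries, and
    [norm_qform] bounds the diagonals of [A] and [B]. *)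
Lemma trace_normD A B : A \is hermsymmx -> B \is hermsymmx ->
  trace_norm (A + B) <= trace_norm A + trace_norm B.
Proof.
move=> hA hB; have [u ou ABE] := herm_diag_op (hermsymD hA hB).
have [e oe AE] := herm_diag_op hA; have [f of_ BE] := herm_diag_op hB.
rewrite [X in trace_norm X <= _]ABE [in X in _ <= X + _]AE [in X in _ <= _ + X]BE.
rewrite !trace_norm_diag_op// [leLHS]tuple_sum.
under eq_bigr => i _ do rewrite -(qform_eigen _ i ou) -ABE qformD.
apply: le_trans (ler_sum _ (fun i _ => ler_normD _ _)) _.
rewrite big_split /=; apply: lerD.
  by under eq_bigr do rewrite [in X in qform X _]AE; exact: norm_qform.
by under eq_bigr do rewrite [in X in qform X _]BE; exact: norm_qform.
Qed.

Lemma diag_opZ e (a : R) x :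
  a%:C *: diag_op e x = diag_op e [tuple a * x`_i | i < d].
Proof.
rewrite /diag_op scaler_sumr; apply: eq_bigr => i _.
by rewrite scalerA nth_mktuple rmorphM.
Qed.

Lemma diag_opD e x y :
  diag_op e x + diag_op e y = diag_op e [tuple x`_i + y`_i | i < d].
Proof.
rewrite /diag_op -big_split; apply: eq_bigr => i _ /=.
by rewrite nth_mktuple rmorphD scalerDl.
Qed.

Lemma diag_opB e x y :
  diag_op e x - diag_op e y = diag_op e [tuple x`_i - y`_i | i < d].
Proof.
rewrite /diag_op -sumrB; apply: eq_bigr => i _ /=.
by rewrite nth_mktuple rmorphB scalerBl.
Qed.

Lemma trace_normZ (a : R) A : 0 <= a -> A \is hermsymmx ->
  trace_norm (a%:C *: A) = a * trace_norm A.
Proof.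
move=> a0 hA; have [e oe ->] := herm_diag_op hA.
rewrite diag_opZ !trace_norm_diag_op// !tuple_sum mulr_sumr.
by apply: eq_bigr => i _; rewrite nth_mktuple normrM ger0_norm.
Qed.

Lemma trace_dist_tri A B D : A \is hermsymmx -> B \is hermsymmx -> D \is hermsymmx ->
  trace_dist A D <= trace_dist A B + trace_dist B D.
Proof.
move=> hA hB hD; rewrite /trace_dist -mulrDr ler_wpM2l ?invr_ge0//.
have -> : A - D = (A - B) + (B - D) by rewrite addrA subrK.
by apply: trace_normD; exact: hermsymB.
Qed.

Lemma trace_dist_mid A B D : A \is hermsymmx -> B \is hermsymmx -> D \is hermsymmx ->
  trace_dist (2^-1%:C *: (A + B)) D <= 2^-1 * (trace_dist A D + trace_dist B D).
Proof.
move=> hA hB hD; rewrite /trace_dist -mulrDr ler_wpM2l ?invr_ge0//.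
have -> : 2^-1%:C *: (A + B) - D = 2^-1%:C *: ((A - D) + (B - D)).
  by apply/matrixP => i j; rewrite !mxE fmorphV rmorph_nat; field.
have hAD := hermsymB hA hD; have hBD := hermsymB hB hD.
rewrite (trace_normZ _ (hermsymD hAD hBD)); last by rewrite invr_ge0.
by rewrite ler_wpM2l ?invr_ge0//; exact: trace_normD.
Qed.

Lemma trace_dist_diag_op e x y : orthonormal_basis e ->
  trace_dist (diag_op e x) (diag_op e y) = 2^-1 * \sum_(i < d) `|x`_i - y`_i|.
Proof.
move=> oe; rewrite /trace_dist diag_opB trace_norm_diag_op// tuple_sum.
by congr (_ * _); apply: eq_bigr => i _; rewrite nth_mktuple.
Qed.

Lemma half_norm_sum x : \sum_(z <- x) z = 0 ->
  2^-1 * \sum_(z <- x) `|z| = excess_sum 0 x.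
Proof.
move=> x0; under eq_bigr do rewrite norm_excess.
rewrite sumrB x0 subr0 sumrMnl /excess_sum.
by set S := \sum_(z <- x) _; lra.
Qed.

Lemma trace_dist_excess A B u x : orthonormal_basis u -> \tr A = \tr B ->
  A - B = diag_op u x -> trace_dist A B = excess_sum 0 x.
Proof.
move=> ou tAB ABE; rewrite /trace_dist ABE trace_norm_diag_op// half_norm_sum//.
by apply: (@complexI R); rewrite -(trace_diag_op _ ou) -ABE linearB /= tAB subrr.
Qed.

(** Write [A = B + (A - B)]. Since the traces agree, the positive part of [A - B] has trace equal to
    the trace distance. *)
Lemma excess_sum_lipschitz t A B e f x y :
  orthonormal_basis e -> orthonormal_basis f ->
  A = diag_op e x -> B = diag_op f y -> \tr A = \tr B ->
  excess_sum t x <= excess_sum t y + trace_dist A B.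
Proof.
move=> oe of_ AE BE tAB.
have hAB : A - B \is hermsymmx by rewrite AE BE hermsymB ?diag_op_herm.
have [u ou ABE] := herm_diag_op hAB.
rewrite (trace_dist_excess ou tAB ABE); apply: (excess_sumD t oe of_ ou).
by rewrite -AE -BE -ABE addrC subrK.
Qed.

Lemma state_herm A : state A -> A \is hermsymmx.
Proof. by case=> -[]. Qed.

Lemma state_diag_op e x : orthonormal_basis e ->
  (forall i, (i < d)%N -> 0 <= x`_i) -> \sum_(z <- x) z = 1 ->
  state (diag_op e x).
Proof.
move=> oe x0 x1; split; last by rewrite trace_diag_op// x1.
split=> [|v]; first exact: diag_op_herm.
rewrite form_diag_op ler0c; apply: sumr_ge0 => j _.
by rewrite mulr_ge0 ?weight_ge0// x0.
Qed.

Lemma state_diag_op_ge0 e x i : orthonormal_basis e -> state (diag_op e x) ->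
  (i < d)%N -> 0 <= x`_i.
Proof.
move=> oe [[_ psd] _] id; rewrite -[leRHS](qform_eigen x (Ordinal id) oe) /qform.
by have := psd (e (Ordinal id)); rewrite lecE => /andP[].
Qed.

Lemma state_diag_op_sum e x : orthonormal_basis e -> state (diag_op e x) ->
  \sum_(z <- x) z = 1.
Proof. by move=> oe [_]; rewrite trace_diag_op// => /(@complexI R). Qed.

Lemma state_mid A B : state A -> state B -> state (2^-1%:C *: (A + B)).
Proof.
move=> [[hA pA] tA] [[hB pB] tB]; split; first split.
- by rewrite hermsymZ ?hermsymD.
- move=> v; rewrite -scalemxAr -scalemxAl mulmxDr mulmxDl mxE mxE.
  by rewrite mulr_ge0 ?addr_ge0// ler0c invr_ge0.
- by rewrite linearZ linearD /= tA tB fmorphV rmorph_nat -mulr2n -mulr_natl mulr1 mulVf ?pnatr_eq0.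
Qed.

(** The squared Hilbert-Schmidt norm. *)
Definition frob A : R := complex.Re (\tr (A^t* *m A)).

Lemma frobE A : frob A = \sum_i \sum_j (complex.Re (A j i) ^+ 2 + complex.Im (A j i) ^+ 2).
Proof.
rewrite /frob /mxtrace raddf_sum; apply: eq_bigr => i _ /=.
rewrite mxE raddf_sum; apply: eq_bigr => j _ /=; rewrite !mxE mulrC -normCK.
by rewrite -add_Re2_Im2.
Qed.

Lemma frob_diag_op e x : orthonormal_basis e ->
  frob (diag_op e x) = \sum_(z <- x) z ^+ 2.
Proof.
move=> oe; rewrite /frob diag_op_trC_mul// trace_diag_op//.
set y := [tuple _ | _ < _]; rewrite -[LHS]/(\sum_(z <- y) z).
rewrite (tuple_sum id y) (tuple_sum (fun z => z ^+ 2)).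
by apply: eq_bigr => i _; rewrite /y nth_mktuple.
Qed.

Lemma frob_mid A B :
  frob (2^-1%:C *: (A + B)) = 2^-1 * (frob A + frob B) - 4^-1 * frob (A - B).
Proof.
rewrite !frobE -big_split !mulr_sumr -sumrB; apply: eq_bigr => i _ /=.
rewrite -big_split !mulr_sumr -sumrB; apply: eq_bigr => j _ /=.
rewrite !mxE; case: (A j i) => a b; case: (B j i) => a' b' /=; by field.
Qed.

Lemma frob_eq0 A : frob A <= 0 -> A = 0.
Proof.
have ge0 j i : 0 <= complex.Re (A j i) ^+ 2 + complex.Im (A j i) ^+ 2.
  by rewrite addr_ge0 ?sqr_ge0.
rewrite frobE => A0; apply/matrixP => j i; rewrite mxE; apply/eqP.
have {}A0 : \sum_i \sum_j (complex.Re (A j i) ^+ 2 + complex.Im (A j i) ^+ 2) = 0.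
  by apply/le_anti; rewrite A0; apply: sumr_ge0 => ? _; apply: sumr_ge0.
have /psumr_eq0P/(_ i isT) := A0; move=> /(_ (fun i _ => sumr_ge0 _ (fun j _ => ge0 j i))).
move=> /psumr_eq0P/(_ j isT) => /(_ (fun j _ => ge0 j i)) /eqP.
by rewrite paddr_eq0 ?sqr_ge0// !sqrf_eq0 eq_complex.
Qed.

Lemma diag_op_reindex e x (s : {perm 'I_d}) :
  diag_op e x = diag_op (fun i => e (s i)) [tuple x`_(s i) | i < d].
Proof.
rewrite /diag_op [LHS](reindex_inj (@perm_inj _ s)) /=.
by apply: eq_bigr => i _; rewrite nth_mktuple.
Qed.

(** The permutation is absorbed into a reordering of the basis [f]; the unitary then carries one
    basis to the other. *)
Lemma diag_op_unitarily_equiv e f x y :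
  orthonormal_basis e -> orthonormal_basis f -> perm_eq x y ->
  unitarily_equiv (diag_op e x) (diag_op f y).
Proof.
move=> oe of_ /tuple_permP[s xs].
have {}xs : x = [tuple y`_(s i) | i < d].
  apply: val_inj; apply: (etrans xs); apply: eq_map => i.
  by rewrite (tnth_nth 0).
have of' : orthonormal_basis (fun i => f (s i)).
  by move=> i j; rewrite of_ (inj_eq perm_inj).
rewrite (diag_op_reindex f y s) -xs.
exists (basis_mx e *m (basis_mx (fun i => f (s i)))^t*).
  by rewrite mul_unitarymx ?trmxC_unitary ?basis_mx_unitary.
rewrite !diag_opE trC_mul trmxCK.
set P := basis_mx e; set Q := basis_mx _; set D := real_diag x.
have QQ : Q^t* *m Q = 1%:M by exact: basis_mxE.
rewrite !mulmxA -(mulmxA P (Q^t*) Q) QQ mulmx1.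
by rewrite -(mulmxA (P *m D) (Q^t*) Q) QQ mulmx1.
Qed.

End QuadraticForm.

(** * The extremal states *)

Section DiagonalStates.
Variables (R : realType) (d : nat).
Local Notation C := R[i].
Implicit Types (A B V : 'M[C]_d) (e : 'I_d -> 'cV[C]_d) (x y : d.-tuple R).

Lemma sum_head_total x : \sum_(0 <= i < d) x`_i = \sum_(z <- x) z.
Proof. by rewrite (tuple_sum id) big_mkord. Qed.

Lemma trace_dist_diag_excess e x y : orthonormal_basis e ->
  \sum_(z <- x) z = \sum_(z <- y) z ->
  trace_dist (diag_op e x) (diag_op e y) = \sum_(i < d) excess 0 (x`_i - y`_i).
Proof.
move=> oe xy; rewrite (trace_dist_excess oe _ (diag_opB e x y)).
  by rewrite /excess_sum tuple_sum; apply: eq_bigr => i _; rewrite nth_mktuple.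
by rewrite !trace_diag_op// xy.
Qed.

Lemma mixed_stateE e : orthonormal_basis e ->
  mixed_state R d = diag_op e [tuple d%:R^-1 | i < d].
Proof.
by move=> oe; rewrite diag_op_const// /mixed_state scalemx1 fmorphV rmorph_nat.
Qed.

Lemma state_maj_diag_opl e x A : orthonormal_basis e ->
  state_maj (diag_op e x) A <-> majorized x (spectrum A).
Proof.
move=> oe; have px := perm_spectrum x oe.
by split; apply: majorized_perm => //; rewrite perm_sym.
Qed.

Lemma state_maj_diag_opr e x A : orthonormal_basis e ->
  state_maj A (diag_op e x) <-> majorized (spectrum A) x.
Proof.
move=> oe; have px := perm_spectrum x oe.
by split; apply: majorized_perm => //; rewrite perm_sym.
Qed.

Lemma state_spectrum_sum A : state A -> \sum_(z <- spectrum A) z = 1.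
Proof.
move=> sA; have [u ou AE] := herm_diag_op (state_herm sA).
by apply: (state_diag_op_sum ou); rewrite -AE.
Qed.

Lemma state_spectrum_ge0 A i : state A -> (i < d)%N -> 0 <= (spectrum A)`_i.
Proof.
move=> sA; have [u ou AE] := herm_diag_op (state_herm sA).
by apply: (state_diag_op_ge0 ou); rewrite -AE.
Qed.

Lemma state_maj_frob A B : A \is hermsymmx -> B \is hermsymmx ->
  state_maj A B -> frob A <= frob B.
Proof.
move=> hA hB /majorized_sqr.
have [u ou AE] := herm_diag_op hA; have [v ov BE] := herm_diag_op hB.
by rewrite [in X in _ -> X <= _]AE [in X in _ -> _ <= X]BE !frob_diag_op.
Qed.

Lemma half_sum_le (a b c : R) : a <= c -> b <= c -> 2^-1 * (a + b) <= c.
Proof. by move=> ? ?; lra. Qed.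

Lemma frob_mid_eq A B : frob A <= frob B ->
  frob B <= frob (2^-1%:C *: (A + B)) -> A = B.
Proof.
rewrite frob_mid => AB BM; apply/eqP; rewrite -subr_eq0; apply/eqP/frob_eq0.
by move: AB BM; move: (frob _) (frob _) (frob _) => x y z; lra.
Qed.

(** The points [A + t V] stay in the affine space, lie outside [B] and tend to [A] as [t] decreases
    to 0. *)
Lemma rel_boundary_perturb (B : set 'M[C]_d) A V :
  (@selfadj_trace1 R d) A -> V \is hermsymmx -> \tr V = 0 -> B A ->
  (forall t : R, 0 < t -> ~ B (A + t%:C *: V)) ->
  rel_boundary (@selfadj_trace1 R d) B A.
Proof.
move=> [hA tA] hV tV BA nB; split; first by split=> //; exact: subset_closure.
move=> N /nbhs_ballP[r /= r0 rN].
pose M : C := \sum_i \sum_j `|V i j|.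
have M0 : 0 <= M by apply: sumr_ge0 => i _; exact: sumr_ge0.
have VM i j : `|V i j| <= M.
  rewrite /M (bigD1 i)//= (bigD1 j)//= -addrA lerDl addr_ge0//.
    exact: sumr_ge0.
  by apply: sumr_ge0 => k _; exact: sumr_ge0.
have M1 : 0 < M + 1 by rewrite ltr_wpDl.
(* The radius [r] is a positive element of [R[i]], hence real. The summand 1 keeps the denominator
   positive and makes the entrywise bound strict. *)
pose t := complex.Re (r / (M + 1)).
have tE : t%:C = r / (M + 1) by apply: RRe_real; apply: gtr0_real; rewrite divr_gt0.
have t0 : 0 < t by rewrite -ltcR tE divr_gt0.
exists (A + t%:C *: V); split.
  split; last exact: nB.
  split; first by rewrite hermsymD ?hermsymZ.
  by rewrite linearD linearZ /= tA tV mulr0 addr0.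
apply: rN; split=> // i j; rewrite -ball_normE /= !mxE opprD addrA subrr sub0r normrN normrM.
rewrite tE ger0_norm ?divr_ge0 ?ltW//.
rewrite mulrAC ltr_pdivrMr// ltr_pM2l//.
by rewrite (le_lt_trans (VM i j))// ltrDl.
Qed.

End DiagonalStates.

Section Extremal.
Variables (R : realType) (d : nat).
Hypothesis d_ge2 : (2 <= d)%N.
Local Notation C := R[i].
Variables (sigma : 'M[C]_d) (e : 'I_d -> 'cV[C]_d) (mu : d.-tuple R).
Hypothesis sigma_state : state sigma.
Hypothesis sigma_eigen : eigendecomp sigma e mu.

Let oe : orthonormal_basis e. Proof. by case: sigma_eigen. Qed.
Let mu_sorted : sorted >=%R mu. Proof. by case: sigma_eigen. Qed.
Let sigmaE : sigma = diag_op e mu. Proof. by case: sigma_eigen. Qed.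
Let dmu_state : state (diag_op e mu). Proof. by rewrite -sigmaE. Qed.
Let mu_ge0 i : (i < d)%N -> 0 <= mu`_i. Proof. exact: state_diag_op_ge0 oe _. Qed.
Let mu_sum : \sum_(z <- mu) z = 1. Proof. exact: state_diag_op_sum oe _. Qed.

Lemma excess_sum_state t omega : state omega ->
  excess_sum t (spectrum omega) <= excess_sum t mu + trace_dist omega sigma /\
  excess_sum t mu <= excess_sum t (spectrum omega) + trace_dist omega sigma.
Proof.
move=> so; have [u ou oE] := herm_diag_op (state_herm so).
have tr_eq : \tr omega = \tr sigma by rewrite (proj2 so) (proj2 sigma_state).
split; first exact: (excess_sum_lipschitz t ou oe oE sigmaE).
by rewrite trace_distC; apply: (excess_sum_lipschitz t oe ou sigmaE oE).
Qed.

Lemma trace_dist_mixed :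
  trace_dist (diag_op e mu) (mixed_state R d) = excess_sum d%:R^-1 mu.
Proof.
rewrite (mixed_stateE oe) trace_dist_diag_excess//.
  rewrite /excess_sum tuple_sum; apply: eq_bigr => i _; rewrite nth_mktuple.
  by rewrite /excess subr0.
rewrite mu_sum (tuple_sum id).
under eq_bigr do rewrite nth_mktuple.
by rewrite sumr_const card_ord dinv_sum// ltnW.
Qed.

Definition clamped (a b : R) : d.-tuple R := [tuple clamp a b mu`_i | i < d].

(** Unites the two cases of [rho_upper]: either both levels collapse to [1/d] and clamping yields
    the mixed state, or the mass cut off is exactly [eps]. The second clause equates the mass raised
    with the mass lowered. *)
Definition clamp_levels (eps a b : R) :=
  [/\ a <= d%:R^-1 <= b, excess_sum (- a) (map -%R mu) = excess_sum b mu
    & [/\ a = d%:R^-1, b = d%:R^-1 & excess_sum d%:R^-1 mu <= eps] \/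
      (excess_sum b mu = eps /\ eps < excess_sum d%:R^-1 mu)].

Lemma rho_upper_clamped (eps : R) : 0 < eps ->
  exists a b, clamp_levels eps a b /\ rho_upper eps e mu = diag_op e (clamped a b).
Proof.
move=> eps0; rewrite /rho_upper trace_dist_mixed.
case: lerP => eps_T.
  exists d%:R^-1, d%:R^-1; split.
    split; [by rewrite lexx|exact: deficit_sum_mean (ltnW d_ge2) mu_sum|by left].
  rewrite (mixed_stateE oe); congr diag_op; apply: eq_from_tnth => i.
  by rewrite !tnth_mktuple clamp_const.
have [a [b [ab sb sa fE]]] := flattened_clamp mu_sorted d_ge2 mu_ge0 mu_sum eps0 eps_T.
exists a, b; split; first by split; rewrite ?sb ?sa//; right.
congr diag_op; apply: eq_from_tnth => i.
by rewrite tnth_mktuple (tnth_nth 0) fE.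
Qed.

(** * The minimal state as a clamped spectrum *)

Section Clamped.
Variables (eps a b : R).
Hypothesis levels : clamp_levels eps a b.
Hypothesis eps_gt0 : 0 < eps.
Let p := clamped a b.

Let ad : a <= d%:R^-1. Proof. by case: levels => /andP[]. Qed.
Let db : d%:R^-1 <= b. Proof. by case: levels => /andP[]. Qed.
Let ab : a <= b. Proof. exact: le_trans ad db. Qed.
Let pE (i : 'I_d) : p`_i = clamp a b mu`_i. Proof. exact: nth_mktuple. Qed.
Let deficitE : \sum_(i < d) excess (- a) (- mu`_i) = excess_sum b mu.
Proof. by case: levels => _ <- _; rewrite /excess_sum big_map tuple_sum. Qed.

Lemma clamped_sum : \sum_(z <- p) z = 1.
Proof.
rewrite (tuple_sum id) -mu_sum (tuple_sum id mu).
apply/esym/eqP; rewrite -subr_eq0 -sumrB.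
under eq_bigr do rewrite pE clamp_decomp//.
by rewrite sumrB deficitE /excess_sum tuple_sum subrr.
Qed.

Lemma clamped_state : state (diag_op e p).
Proof.
apply: state_diag_op => //; last exact: clamped_sum.
move=> i id; rewrite (nth_tuple_ord _ id) /= /clamp le_max le_min mu_ge0//.
by rewrite (le_trans _ db) ?orbT// invr_ge0 ler0n.
Qed.

Lemma clamped_dist : trace_dist (diag_op e p) sigma = excess_sum b mu.
Proof.
rewrite sigmaE trace_dist_diag_excess ?clamped_sum// -deficitE.
by apply: eq_bigr => i _; rewrite pE excess_clamp_sub.
Qed.

Lemma clamped_tball : tball eps sigma (diag_op e p).
Proof.
split; first exact: clamped_state.
by rewrite clamped_dist; case: levels => _ _ [[_ -> //]|[-> _]].
Qed.

Lemma clamped_maj omega : tball eps sigma omega -> state_maj (diag_op e p) omega.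
Proof.
move=> [so dist_o]; apply/(state_maj_diag_opl _ _ oe).
apply: majorized_excess => [t|]; last by rewrite clamped_sum state_spectrum_sum.
have [ta|/ltW at_] := lerP t a.
  (* All entries of [p] are at least [t], so its excess sum is the total of the differences, a lower
     bound for every spectrum of total 1. *)
  have -> : excess_sum t p = \sum_(z <- spectrum omega) (z - t).
    rewrite sumrB state_spectrum_sum// -clamped_sum.
    rewrite sum_const_tuple -(sum_const_tuple p) -sumrB /excess_sum.
    rewrite !tuple_sum; apply: eq_bigr => i _; rewrite excessE// pE.
    by rewrite (le_trans ta)//; case/andP: (clamp_bounds ab mu`_i).
  by apply: ler_sum => z _; exact: excess_ge.
have [tb|/ltW bt] := lerP t b; last first.
  rewrite /excess_sum tuple_sum big1; first by apply: sumr_ge0 => z _; exact: excess_ge0.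
  move=> i _; rewrite pE excess_eq0// (le_trans _ bt)//.
  by case/andP: (clamp_bounds ab mu`_i).
have -> : excess_sum t p = excess_sum t mu - excess_sum b mu.
  rewrite /excess_sum !tuple_sum -sumrB; apply: eq_bigr => i _.
  by rewrite pE excess_clamp_mid// at_ tb.
have [_ mu_o] := excess_sum_state t so.
case: levels => _ _ [[aE bE _]|[-> _]].
  (* The levels coincide here, and [t] lies between them. *)
  have tE : t = b by apply/le_anti; rewrite tb bE -aE at_.
  by rewrite tE subrr; apply: sumr_ge0 => z _; exact: excess_ge0.
by rewrite lerBlDr (le_trans mu_o)// lerD2l.
Qed.

(** Minimality of [rho] gives [frob rho <= frob p], and minimality of [p], tested on the midpoint,
    bounds [frob p] by its norm. The parallelogram law then forces equality. *)
Lemma clamped_unique rho : tball eps sigma rho ->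
  (forall omega, tball eps sigma omega -> state_maj rho omega) ->
  rho = diag_op e p.
Proof.
move=> rho_ball rho_min; have [rho_state rho_dist] := rho_ball.
have [p_state p_dist] := clamped_tball.
have hr := state_herm rho_state; have hp := state_herm p_state.
have mid_ball : tball eps sigma (2^-1%:C *: (rho + diag_op e p)).
  split; first exact: state_mid.
  apply: le_trans (trace_dist_mid hr hp (state_herm sigma_state)) _.
  exact: half_sum_le.
have := state_maj_frob hp (state_herm (proj1 mid_ball)) (clamped_maj mid_ball).
have := state_maj_frob hr hp (rho_min _ clamped_tball).
exact: frob_mid_eq.
Qed.

(** In the nondegenerate case the distance to [sigma] is exactly [eps], and moving on along the ray
    from [sigma] multiplies it by [1 + t]. *)
Lemma clamped_boundary :
  diag_op e p = mixed_state R d \/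
  rel_boundary (@selfadj_trace1 R d) (tball eps sigma) (diag_op e p).
Proof.
case: levels => _ _ [[aE bE _]|[bE _]].
  left; rewrite (mixed_stateE oe); congr diag_op; apply: eq_from_tnth => i.
  by rewrite !tnth_mktuple clamp_const ?aE.
right; have [ph pt] : (@selfadj_trace1 R d) (diag_op e p).
  by split; [exact: state_herm clamped_state|case: clamped_state].
have psE : diag_op e p - diag_op e mu = diag_op e [tuple p`_i - mu`_i | i < d] by exact: diag_opB.
have hps : diag_op e p - diag_op e mu \is hermsymmx by rewrite psE diag_op_herm.
apply: (rel_boundary_perturb (conj ph pt) hps).
- by rewrite linearB /= pt (proj2 dmu_state) subrr.
- exact: clamped_tball.
move=> t t0 [_]; apply/negP; rewrite -ltNge.
have -> : trace_dist (diag_op e p + t%:C *: (diag_op e p - diag_op e mu)) sigma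
    = (1 + t) * trace_dist (diag_op e p) sigma.
  have t1 : 0 <= 1 + t by rewrite addr_ge0// ltW.
  rewrite /trace_dist sigmaE mulrCA -(trace_normZ t1 hps); congr (_ * trace_norm _).
  by rewrite rmorphD rmorph1 scalerDl scale1r addrAC.
by rewrite clamped_dist bE ltr_pMl// ltrDl.
Qed.

Lemma clamped_additive :
  trace_dist sigma (mixed_state R d)
  = trace_dist (mixed_state R d) (diag_op e p) + trace_dist (diag_op e p) sigma.
Proof.
rewrite sigmaE (mixed_stateE oe) !trace_dist_diag_op// -mulrDr -big_split.
congr (_ * _); apply: eq_bigr => i _ /=.
by rewrite nth_mktuple pE (norm_clamp ab) ?ad.
Qed.

End Clamped.

(** The levels for [eps1 + eps2] lie inside those for [eps2], so the distance is the difference of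
    the two amounts cut off. *)
Lemma clamped_semigroup_dist (eps1 eps2 a b a' b' : R) :
  0 < eps1 -> clamp_levels eps2 a b -> clamp_levels (eps1 + eps2) a' b' ->
  trace_dist (diag_op e (clamped a' b')) (diag_op e (clamped a b)) <= eps1.
Proof.
move=> eps1_gt0 lev lev'.
have [/andP[ad db] sa cases] := lev; have [/andP[ad' db'] sa' cases'] := lev'.
rewrite trace_distC trace_dist_diag_excess//; last first.
  by rewrite (clamped_sum lev) (clamped_sum lev').
have [aa' bb' dE] : [/\ a <= a', b' <= b & excess_sum b' mu - excess_sum b mu <= eps1].
  case: cases' => [[-> -> T_le]|[bE' T_gt]].
    by split=> //; case: cases => [[_ -> _]|[-> _]]; lra.
  (* As [eps1 + eps2] is below the distance to the mixed state, so is [eps2]; the first pair of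
     levels cannot be collapsed. *)
  have bE : excess_sum b mu = eps2.
    by case: cases => [[_ -> T_le]|[-> //]]; lra.
  split.
  - rewrite leNgt; apply/negP => lt; have := @excess_sum_le_anti _ (map -%R mu) (- a) (- a').
    by rewrite lerN2 sa sa' bE bE' => /(_ (ltW lt)); lra.
  - rewrite leNgt; apply/negP => lt; have := @excess_sum_le_anti _ mu b b' (ltW lt).
    by rewrite bE bE'; lra.
  - by rewrite bE bE'; lra.
rewrite (le_trans _ dE)// /excess_sum !tuple_sum -sumrB; apply: ler_sum => i _.
by rewrite !nth_mktuple excess_clamp2//; lra.
Qed.

(** * The maximal state *)

Section Lower.
Variable eps : R.
Hypothesis eps_gt0 : 0 < eps.
Let p := steepened eps mu.

Let mu_sum_nat : \sum_(0 <= i < d) mu`_i = 1.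
Proof. by rewrite sum_head_total. Qed.
Let spec := steepened_spec d_ge2 mu_ge0 mu_sum_nat eps_gt0.
Let p_sum : \sum_(z <- p) z = 1.
Proof. by rewrite -sum_head_total; case: spec => -[]. Qed.

Lemma rho_lower_state : state (rho_lower eps e mu).
Proof. by apply: state_diag_op => //; case: spec => -[]. Qed.

(** Only the entry at index 0 can increase, and by at most [eps]; its increase is the whole positive
    part of the difference. *)
Lemma rho_lower_tball : tball eps sigma (rho_lower eps e mu).
Proof.
split; first exact: rho_lower_state.
rewrite sigmaE trace_dist_diag_excess//; last by rewrite p_sum.
have d0 : (0 < d)%N by lia.
case: spec => _ p0 pi _ _.
rewrite (bigD1 (Ordinal d0))//= [X in _ + X]big1 ?addr0.
  rewrite /excess subr0 ge_max (ltW eps_gt0)/=; move: p0; rewrite -/p; lra.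
move=> i i0; apply: excess_eq0; rewrite subr_le0; apply: pi.
by rewrite ltn_ord andbT lt0n.
Qed.

Lemma rho_lower_maj omega : tball eps sigma omega ->
  state_maj omega (rho_lower eps e mu).
Proof.
move=> [so dist_o]; apply/(state_maj_diag_opr _ _ oe); split; last first.
  by rewrite !sum_head_total state_spectrum_sum// p_sum.
move=> k /andP[k0 kd]; have {}kd : (k < d)%N by lia.
(* Rearranging only enlarges head sums, so the bound can be proved for [p] in its given order. *)
apply: le_trans (head_sum_decr_rearr p (ltnW kd)).
case: spec => _ _ _ _ /(_ k); rewrite k0 kd => /(_ isT)[]; apply: le_trans.
  apply: head_sum_excess_le => //; first by rewrite k0 ltnW.
  move=> t; have [le_o _] := excess_sum_state t so.
  by rewrite (le_trans le_o)// lerD2l.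
rewrite -(state_spectrum_sum so); apply: head_sum_le_total; last exact: ltnW.
by move=> i; exact: state_spectrum_ge0.
Qed.

Lemma rho_lower_boundary :
  rel_boundary (@selfadj_trace1 R d) (tball eps sigma) (rho_lower eps e mu).
Proof.
have d0 : (0 < d)%N by lia.
have dl : (d.-1 < d)%N by lia.
(* Along [v], weight moves from the last eigenvector to the first. Either the distance then exceeds
   [eps], or the last eigenvalue, already 0, becomes negative. *)
pose v : d.-tuple R := [tuple (i == 0%N :> nat)%:R - (i == d.-1 :> nat)%:R | i < d].
have v_sum : \sum_(z <- v) z = 0.
  rewrite (tuple_sum id); under eq_bigr do rewrite nth_mktuple.
  rewrite sumrB (bigD1 (Ordinal d0))//= big1 => [|i /negbTE i0].
    rewrite (bigD1 (Ordinal dl))//= big1 ?eqxx ?addr0 ?subrr// => i /negbTE il.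
    by rewrite -(inj_eq val_inj) /= in il; rewrite il.
  by rewrite -(inj_eq val_inj) /= in i0; rewrite i0.
have v0 : v`_0 = 1.
  by rewrite (nth_tuple_ord _ d0) /= (_ : (0 == d.-1)%N = false) ?subr0//; lia.
have vl : v`_d.-1 = -1.
  by rewrite (nth_tuple_ord _ dl) /= eqxx (_ : (d.-1 == 0)%N = false) ?sub0r//; lia.
apply: (@rel_boundary_perturb _ _ _ _ (diag_op e v)).
- by split; [exact: diag_op_herm|case: rho_lower_state].
- exact: diag_op_herm.
- by rewrite trace_diag_op// v_sum.
- exact: rho_lower_tball.
move=> t t0; rewrite diag_opZ /rho_lower diag_opD.
set w := [tuple _ | _ < _]; have wE i : (i < d)%N -> w`_i = p`_i + t * v`_i.
  by move=> id; rewrite (nth_tuple_ord _ id)/= (nth_tuple_ord _ id).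
case: spec => _ _ _ + _; rewrite -/p => -[p0|pl] [w_state w_dist].
  have w_sum := state_diag_op_sum oe w_state.
  move: w_dist; rewrite sigmaE trace_dist_diag_excess ?w_sum//.
  apply/negP; rewrite -ltNge (bigD1 (Ordinal d0))//=.
  apply: (@lt_le_trans _ _ (excess 0 (w`_0 - mu`_0))).
    by apply: lt_le_trans (excess_ge _ _); rewrite wE// v0 p0; lra.
  by rewrite lerDl; apply: sumr_ge0 => i _; exact: excess_ge0.
have := state_diag_op_ge0 oe w_state dl; rewrite wE// pl vl; lra.
Qed.

End Lower.
End Extremal.

Theorem theorem3p1 (R : realType) (d : nat) (hd : (2 <= d)%N)
    (sigma : 'M[R[i]]_d) (hsigma : state sigma)
    (e : 'I_d -> 'cV[R[i]]_d) (mu : d.-tuple R)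
    (hmu : eigendecomp sigma e mu)
    (eps : R) (heps : 0 < eps <= 1) :
  [/\ state (rho_upper eps e mu) /\ tball eps sigma (rho_upper eps e mu),
      state (rho_lower eps e mu) /\ tball eps sigma (rho_lower eps e mu)
    & forall omega, tball eps sigma omega ->
        state_maj (rho_upper eps e mu) omega /\
        state_maj omega (rho_lower eps e mu)]
  /\
  [/\ (* (i) *)
      forall rho, (tball eps sigma rho /\
          forall omega, tball eps sigma omega -> state_maj rho omega)
        <-> rho = rho_upper eps e mu,
      (* (ii) *)
      forall rho, tball eps sigma rho ->
        (forall omega, tball eps sigma omega -> state_maj omega rho) ->
        unitarily_equiv rho (rho_lower eps e mu),
      (* (iii) *)
      rel_boundary (@selfadj_trace1 R d) (tball eps sigma)
        (rho_lower eps e mu) /\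
      (rho_upper eps e mu = mixed_state R d \/
       rel_boundary (@selfadj_trace1 R d) (tball eps sigma)
         (rho_upper eps e mu)),
      (* (iv) *)
      forall eps1 eps2 : R, 0 < eps1 <= 1 -> 0 < eps2 <= 1 ->
        forall (e' : 'I_d -> 'cV[R[i]]_d) (mu' : d.-tuple R),
          eigendecomp (rho_upper eps2 e mu) e' mu' ->
          rho_upper (eps1 + eps2) e mu = rho_upper eps1 e' mu'
    & (* (v) *)
      trace_dist sigma (mixed_state R d)
      = trace_dist (mixed_state R d) (rho_upper eps e mu)
        + trace_dist (rho_upper eps e mu) sigma].
Proof.
have [eps0 _] := andP heps; have [oe _ sigmaE] := hmu.
have [a [b [lev upE]]] := rho_upper_clamped hd hsigma hmu eps0.
have up_ball := clamped_tball hsigma hmu lev.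
have low_ball := rho_lower_tball hd hsigma hmu eps0.
have up_maj := clamped_maj hsigma hmu lev.
have low_maj := rho_lower_maj hd hsigma hmu eps0.
rewrite upE; split; first split.
- by split; [case: up_ball|].
- by split; [case: low_ball|].
- by move=> omega ball; split; [exact: up_maj|exact: low_maj].
split.
- move=> rho; split=> [[rho_ball rho_min]|->]; last by split.
  exact: (clamped_unique hsigma hmu lev).
- move=> rho rho_ball rho_max.
  have rho_herm := state_herm (proj1 rho_ball).
  have [u ou rhoE] := herm_diag_op rho_herm.
  (* Two maximal elements majorize each other, so their spectra agree up to order. *)
  have spec_perm : perm_eq (spectrum rho) (steepened eps mu).
    apply: majorized_anti.
    - exact: (proj1 (state_maj_diag_opr _ _ oe) (low_maj _ rho_ball)).
    - exact: (proj1 (state_maj_diag_opl _ _ oe) (rho_max _ low_ball)).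
  by rewrite [in X in unitarily_equiv X _]rhoE; exact: diag_op_unitarily_equiv.
- split; first exact: (rho_lower_boundary hd hsigma hmu eps0).
  exact: (clamped_boundary hsigma hmu lev eps0).
- move=> eps1 eps2 /andP[eps1_gt0 _] /andP[eps2_gt0 _] e' mu' eigen'.
  have eps12_gt0 : 0 < eps1 + eps2 by rewrite addr_gt0.
  have [a2 [b2 [lev2 up2E]]] := rho_upper_clamped hd hsigma hmu eps2_gt0.
  have [a3 [b3 [lev3 up3E]]] := rho_upper_clamped hd hsigma hmu eps12_gt0.
  have [state2 dist2] := clamped_tball hsigma hmu lev2.
  have state3 := clamped_state hsigma hmu lev3.
  rewrite up2E in eigen'.
  have [a1 [b1 [lev1 up1E]]] := rho_upper_clamped hd state2 eigen' eps1_gt0.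
  (* Uniqueness is applied in the ball of radius [eps1] around the intermediate state. By the
     triangle inequality this ball lies in that of radius [eps1 + eps2] around [sigma], whose
     minimal state belongs to it. *)
  rewrite up1E up3E; apply: (clamped_unique state2 eigen' lev1).
    by split=> //; exact: (clamped_semigroup_dist hsigma hmu eps1_gt0 lev2 lev3).
  move=> omega [omega_state omega_dist].
  apply: (clamped_maj hsigma hmu lev3); split=> //.
  apply: le_trans (lerD omega_dist dist2).
  by apply: trace_dist_tri; exact: state_herm.
- exact: (clamped_additive hmu lev).
Qed.
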